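(* Consider the distributed cooperative multi-agent multi-armed bandit problem under the constrained reward model with sub-Gaussian rewards, in which all agents use the coop-UCB2-selective-learning algorithm with parameters $\sigma_g>0$, $\gamma>1$, $\eta\in(0,4)$ and increasing sublogarithmic function $f$. Then the expected cumulative regret of the group satisfies $$R^{\text{con}}(T)\le\sum_{k=1}^MR^k(T)\le m_{i^*}NB+\sum_{k=1}^Mm_{b^k}B,$$ where $$B=\frac{4\sigma_g^2\gamma}{\Delta_{\min}^2G(\eta)}\left(1+\sqrt{1+\frac{\Delta_{\min}^2MG(\eta)}{2\sigma_g^2\gamma}\frac{f(T)}{\ln T}}\right)\ln T+\bar L,$$ $$\bar L=\sum_{k=1}^M(t_k^\dagger-1)+M(1+\epsilon_n)+1+\frac{2M(N+1)}{\ln(1+\eta)}\left(\frac{1}{(\gamma-1)^2}+\frac{\gamma\ln\big((1+\epsilon_n)(1+\eta)\big)}{\gamma-1}+1\right),$$ and $t_k^\dagger=f^{-1}(\epsilon_c^k)$.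
   Context: There are $M$ agents and $N$ arms, $M\le N$. The agents are the nodes of a connected undirected graph $\mathcal G$ with Laplacian $L_{\mathcal G}\in\mathbb R^{M\times M}$ and maximum degree $d_{\max}$. Set $P=I_M-\frac{\kappa}{d_{\max}}L_{\mathcal G}$ with $\kappa\in(0,1]$. The eigenvalues of $P$ are $\lambda_1=1>\lambda_2\ge\dots\ge\lambda_M>-1$ (standing assumption), with corresponding orthonormal eigenvectors $\mathbf u_1,\dots,\mathbf u_M$, $\mathbf u_1=\mathbf 1_M/\sqrt M$; $u_p^d$ denotes the $d$-th entry of $\mathbf u_p$. At each time $t=1,\dots,T$ agent $k$ selects one arm $i^k(t)$; $\xi_i^k(t)=1$ if $i^k(t)=i$ and $0$ otherwise. $r_i^k(t)$ is the realized reward at arm $i$ for agent $k$ at time $t$. For each $i$ and $k$, $\{r_i^k(t)\}_t$ is i.i.d. sub-Gaussian with mean $m_i$; rewards of different agents are independent and identically distributed for a given arm, and rewards at time $t$ are independent of all measurements before time $t$. A real random variable $X$ with mean $m$ is sub-Gaussian (with parameter $\sigma_g>0$) if $\ln\mathbb E[\exp(\beta X)]\le m\beta+\frac{\sigma_g^2\beta^2}{2}$ for all $\beta\in\mathbb R$. Constrained reward model: agent $k$ receives $r_{i^k(t)}^k(t)$ at time $t$ only if it is the only agent selecting arm $i^k(t)$ at time $t$, and otherwise receives no reward; however, agents still observe the value of the reward $r_{i^k(t)}^k(t)$ that they did not receive and use it in updating their estimates. The arm means are distinct: $m_{b^1}>m_{b^2}>\dots>m_{b^N}$ where $(b^1,\dots,b^N)$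 is a permutation of the arms; $i^*=b^1$; $\Delta_{\min}=\min\{|m_i-m_j|: i\ne j\}$. Agent $k$ has preassigned rank $k$ and targets the $k$-th best arm $b^k$. Let $\mathbb I_i^k(t)=1$ if agent $k$ is the only agent to sample arm $i$ at time $t$, and $0$ otherwise. The expected cumulative regret of agent $k$ is $$R^k(T)=\sum_{t=1}^T\Big[m_{b^k}-\mathbb E\Big[\sum_{i=1}^Nr_i^k(t)\,\mathds 1\{i^k(t)=i\}\,\mathbb I_i^k(t)\Big]\Big],$$ and the expected cumulative group regret is $$R^{\text{con}}(T)=T\sum_{k=1}^Mm_{b^k}-\mathbb E\Big[\sum_{t=1}^T\sum_{k=1}^Mm_{i^k(t)}\,\mathbb I_{i^k(t)}^k(t)\Big].$$ Cooperative estimation: $\hat{\mathbf n}_i(t)=P(\hat{\mathbf n}_i(t-1)+\boldsymbol\xi_i(t))$, $\hat{\mathbf s}_i(t)=P(\hat{\mathbf s}_i(t-1)+\mathbf r_i(t))$, $\hat{\mathbf n}_i(0)=\hat{\mathbf s}_i(0)=0$, $\hat\mu_i^k(t)=\hat s_i^k(t)/\hat n_i^k(t)$, where $\hat{\mathbf n}_i,\hat{\mathbf s}_i,\boldsymbol\xi_i,\mathbf r_i$ are the vectors over $k\in\{1,\dots,M\}$ with entries $\hat n_i^k,\hat s_i^k,\xi_i^k,r_i^k\xi_i^k$. coop-UCB2-selective-learning algorithm: for $t\le N$ agents sample in round-robin fashion, agent $k$ selecting arm $(t-1+k)\bmod N$ (residue $0$ meaning arm $N$). For $t>N$, with $$C_i^k(t-1)=\sigma_g\sqrt{\frac{2\gamma}{G(\eta)}\cdot\frac{\hat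 n_i^k(t-1)+f(t-1)}{M\hat n_i^k(t-1)}\cdot\frac{\ln(t-1)}{\hat n_i^k(t-1)}},\qquad G(\eta)=1-\frac{\eta^2}{16},$$ each agent $k$ forms the set $\mathcal O_k(t)$ of the $k$ arms with the $k$ highest values of $Q_i^k(t-1)=\hat\mu_i^k(t-1)+C_i^k(t-1)$, $i\in\{1,\dots,N\}$, and then selects an arm in $\mathcal O_k(t)$ minimizing $W_i^k(t-1)=\hat\mu_i^k(t-1)-C_i^k(t-1)$ over $i\in\mathcal O_k(t)$. The estimates are updated at each time with the cooperative estimation algorithm. Here $f$ is increasing and sublogarithmic ($f(t)/\ln t\to0$), and $f^{-1}$ is its inverse (the notation presupposes that each $\epsilon_c^k$ lies in the range of $f$). The graph explore-exploit index is $$\epsilon_n=\sqrt M\sum_{p=2}^M\frac{|\lambda_p|}{1-|\lambda_p|}.$$ The nodal explore-exploit centrality index of node $k$ is $$\epsilon_c^k=M\sum_{p=1}^M\sum_{j=2}^M\frac{|\lambda_p\lambda_j|}{1-|\lambda_p\lambda_j|}a_{pj}(k),$$ where $a_{pj}(k)=\nu_{pj}^{\text{+sum}}u_p^ku_j^k$ if $\lambda_p\lambda_j\ge0$ and $u_p^ku_j^k\ge0$; $a_{pj}(k)=\nu_{pj}^{\text{-sum}}u_p^ku_j^k$ if $\lambda_p\lambda_j\ge0$ and $u_p^ku_j^k\le0$; $a_{pj}(k)=\nu_{pj}^{\max}|u_p^ku_j^k|$ if $\lambda_p\lambda_j<0$; with $\nu_{pj}^{\text{+sum}}=\sum_{d=1}^Mu_p^du_j^d\,\mathds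 1(u_p^du_j^d\ge0)$, $\nu_{pj}^{\text{-sum}}=\sum_{d=1}^Mu_p^du_j^d\,\mathds 1(u_p^du_j^d\le0)$, $\nu_{pj}^{\max}=\max\{|\nu_{pj}^{\text{-sum}}|,\nu_{pj}^{\text{+sum}}\}$, where $\mathds 1(\cdot)$ is the indicator function.
   Formalization: The second inequality is proved under the added assumption that all arm means m_i are nonnegative; without it the bound is false (e.g. M=N=2, T=2, constant rewards −1 and −2: regret 0, bound −5B<0). The first inequality is proved for all means. *)

(* Defs.v *)
From HB Require Import structures.
From mathcomp Require Import all_boot all_order all_algebra all_fingroup.
From mathcomp Require Import all_classical all_reals all_analysis.

Set Implicit Arguments.
Unset Strict Implicit.
Unset Printing Implicit Defensive.

Import Order.TTheory GRing.Theory Num.Theory.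
Import numFieldNormedType.Exports.

Local Open Scope classical_set_scope.
Local Open Scope ring_scope.

(* Agents are 'I_M and arms are 'I_N, numbered from
   0, so the agent [k : 'I_M] is the one of rank [k.+1]; times are naturals,
   numbered from 1. *)

(** Communication graph *)

Definition simple_graph (M : nat) (e : rel 'I_M) :=
  symmetric e /\ irreflexive e.

Definition connected_graph (M : nat) (e : rel 'I_M) :=
  forall x y, connect e x y.

Definition degree (M : nat) (e : rel 'I_M) (x : 'I_M) : nat :=
  #|[set y | e x y]%SET|.

Definition max_degree (M : nat) (e : rel 'I_M) : nat :=
  (\max_(x < M) degree e x)%N.

Definition laplacian (R : realType) (M : nat) (e : rel 'I_M) : 'M[R]_M :=
  \matrix_(i, j) ((degree e i)%:R *+ (i == j) - (e i j)%:R).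

Definition consensus_matrix (R : realType) (M : nat) (e : rel 'I_M)
    (kappa : R) : 'M[R]_M :=
  1%:M - (kappa / (max_degree e)%:R) *: laplacian R e.

(* [lam p] and [u p] are the (p+1)-st eigenvalue and eigenvector. *)
Definition consensus_spectrum (R : realType) (M : nat) (P : 'M[R]_M)
    (lam : 'I_M -> R) (u : 'I_M -> 'cV[R]_M) :=
  [/\ forall p, P *m u p = lam p *: u p,
      forall p q, (u p)^T *m u q = ((p == q)%:R)%:M,
      forall p : 'I_M, p = 0%N :> nat ->
        lam p = 1 /\ u p = const_mx (Num.sqrt (M%:R : R))^-1,
      forall p : 'I_M, (0 < p)%N -> lam p < 1 &
      (forall p q : 'I_M, (p <= q)%N -> lam q <= lam p) /\
      (forall p, -1 < lam p) ].

Section ExploreExploitIndices.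
Variables (R : realType) (M : nat) (lam : 'I_M -> R) (u : 'I_M -> 'cV[R]_M).

Definition eps_n : R :=
  Num.sqrt M%:R * \sum_(p < M | (0 < p)%N) (`|lam p| / (1 - `|lam p|)).

Let uu (p j d : 'I_M) : R := u p d 0 * u j d 0.

Definition nu_psum (p j : 'I_M) : R := \sum_(d < M | 0 <= uu p j d) uu p j d.

Definition nu_nsum (p j : 'I_M) : R := \sum_(d < M | uu p j d <= 0) uu p j d.

Definition nu_max (p j : 'I_M) : R := Num.max `|nu_nsum p j| (nu_psum p j).

Definition a_coef (p j k : 'I_M) : R :=
  if 0 <= lam p * lam j then
    if 0 <= uu p j k then nu_psum p j * uu p j k else nu_nsum p j * uu p j k
  else nu_max p j * `|uu p j k|.

Definition eps_c (k : 'I_M) : R :=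
  M%:R * \sum_(p < M) \sum_(j < M | (0 < j)%N)
           (`|lam p * lam j| / (1 - `|lam p * lam j|) * a_coef p j k).

End ExploreExploitIndices.

(** Probability *)

Section Probability.
Context (R : realType) (d : measure_display) (Omega : measurableType d).
Variable Pr : probability Omega R.

Definition mutually_independent (I : choiceType) (J : set I)
    (X : I -> {RV Pr >-> R}) :=
  forall (s : seq I) (A : I -> set R), uniq s -> [set` s] `<=` J ->
    (forall j, measurable (A j)) ->
    Pr (\bigcap_(j in [set` s]) (X j @^-1` A j)) =
    (\big[mule/1]_(j <- s) Pr (X j @^-1` A j))%E.

Definition identically_distributed (I : choiceType) (J : set I)
    (X : I -> {RV Pr >-> R}) :=
  forall j j', J j -> J j' ->
    forall A : set R, measurable A ->
      distribution Pr (X j) A = distribution Pr (X j') A.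

Definition independent_events (F G : set (set Omega)) :=
  forall A B, F A -> G B -> Pr (A `&` B) = (Pr A * Pr B)%E.

Definition sub_gaussian (X : {RV Pr >-> R}) (m sg : R) :=
  ('E_Pr[X] = m%:E)%E /\
  forall beta : R,
    (lne ('M_Pr X beta) <= (m * beta + sg ^+ 2 * beta ^+ 2 / 2)%:E)%E.

End Probability.

(** Rewards and selections: [r i k t] is the reward at arm [i] for agent [k] at
    time [t], and [a k t] is the arm that agent [k] selects at time [t]. *)

Section RewardModel.
Context (R : realType) (d : measure_display) (Omega : measurableType d).
Variables (Pr : probability Omega R) (M N T : nat).
Variable r : 'I_N -> 'I_M -> nat -> {RV Pr >-> R}.
Variable a : 'I_M -> nat -> Omega -> 'I_N.

Definition rewards_at (t : nat) : set (set Omega) :=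
  <<s [set A | exists i k (B : set R), measurable B /\ A = r i k t @^-1` B] >>.

(* The measurement of agent [k] at time [s] is the value of the reward of the
   arm it selects, whether or not that reward is received. The selections up to
   and including time [t] are part of the history: the selection rule leaves
   ties open, and this says that ties are not broken by looking ahead. When
   ties are broken by a function of the past measurements, the selections add
   nothing to the history. *)
Definition history_before (t : nat) : set (set Omega) :=
  <<s [set A | (exists k s (B : set R), [/\ (0 < s < t)%N, measurable B &
                  A = [set w | B (r (a k s w) k s w)]]) \/
               (exists k s i, (0 < s <= t)%N /\ A = a k s @^-1` [set i])] >>.

Definition random_selections :=
  forall k t i, (0 < t <= T)%N -> measurable (a k t @^-1` [set i]).

Definition reward_model (m : 'I_N -> R) (sg : R) :=
  [/\ forall i k t, (0 < t <= T)%N -> sub_gaussian (r i k t) (m i) sg,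
      forall i, mutually_independent [set kt : 'I_M * nat | (0 < kt.2 <= T)%N]
                  (fun kt => r i kt.1 kt.2),
      forall i, identically_distributed
                  [set kt : 'I_M * nat | (0 < kt.2 <= T)%N]
                  (fun kt => r i kt.1 kt.2) &
      forall t, (0 < t <= T)%N ->
        independent_events Pr (rewards_at t) (history_before t) ].

End RewardModel.

(** Cooperative estimation, along one realization of rewards and selections *)

Section Estimation.
Variables (R : realType) (M N : nat) (P : 'M[R]_M).
Variables (r : 'I_N -> 'I_M -> nat -> R) (a : 'I_M -> nat -> 'I_N).

Definition xi (i : 'I_N) (k : 'I_M) (t : nat) : R := (a k t == i)%:R.

Fixpoint nhat (i : 'I_N) (t : nat) : 'cV[R]_M :=
  if t is s.+1 then P *m (nhat i s + \col_k xi i k t) else 0.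

Fixpoint shat (i : 'I_N) (t : nat) : 'cV[R]_M :=
  if t is s.+1 then P *m (shat i s + \col_k (r i k t * xi i k t)) else 0.

Definition muhat (i : 'I_N) (k : 'I_M) (t : nat) : R :=
  shat i t k 0 / nhat i t k 0.

Variables (sg gamma eta : R) (f : R -> R).

Definition G_eta : R := 1 - eta ^+ 2 / 16.

Definition C_bonus (i : 'I_N) (k : 'I_M) (t : nat) : R :=
  let n := nhat i t k 0 in
  sg * Num.sqrt (2 * gamma / G_eta * ((n + f t%:R) / (M%:R * n))
                 * (ln t%:R / n)).

Definition Q_upper (i : 'I_N) (k : 'I_M) (t : nat) : R :=
  muhat i k t + C_bonus i k t.

Definition W_lower (i : 'I_N) (k : 'I_M) (t : nat) : R :=
  muhat i k t - C_bonus i k t.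

Definition top_arms (k : 'I_M) (t : nat) (O : {set 'I_N}) :=
  #|O| = k.+1 /\
  forall i j, i \in O -> j \notin O -> Q_upper j k t <= Q_upper i k t.

(* With arms and agents numbered from 1, the round-robin arm of agent k at time
   t is (t - 1 + k) mod N, residue 0 meaning N; numbered from 0 it is
   (t - 1 + k) mod N as well. *)
Definition coop_UCB2_selective_learning_at (k : 'I_M) (t : nat) :=
  if (t <= N)%N then a k t = ((t.-1 + k) %% N)%N :> nat
  else exists O : {set 'I_N},
    [/\ top_arms k t.-1 O, a k t \in O &
        forall j, j \in O -> W_lower (a k t) k t.-1 <= W_lower j k t.-1].

End Estimation.

(* [P] is the consensus matrix, [Pr] the probability. *)
Definition coop_UCB2_selective_learning (R : realType) (d : measure_display)
    (Omega : measurableType d) (Pr : probability Omega R) (M N T : nat)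
    (P : 'M[R]_M) (sg gamma eta : R) (f : R -> R)
    (r : 'I_N -> 'I_M -> nat -> {RV Pr >-> R})
    (a : 'I_M -> nat -> Omega -> 'I_N) :=
  forall k t w, (0 < t <= T)%N ->
    coop_UCB2_selective_learning_at P (fun i k t => r i k t w)
      (fun k t => a k t w) sg gamma eta f k t.

(** The function f: [t0] is the left end of its domain. *)

Definition increasing_sublogarithmic (R : realType) (t0 : R) (f : R -> R) :=
  {in `[t0, +oo[ &, {homo f : x y / x < y}} /\
  f x / ln x @[x --> +oo] --> (0 : R).

(* This is f^-1 (y) when y lies in f @` [t0, +oo[. *)
Definition f_inv (R : realType) (t0 : R) (f : R -> R) (y : R) : R :=
  'pinv_(fun=> 0) [set x | t0 <= x] f y.

(** Arms and regret *)

Section Regret.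
Variables (R : realType) (M N : nat) (hMN : (M <= N)%N).
Variables (m : 'I_N -> R) (b : {perm 'I_N}).

Definition ranking := forall i j : 'I_N, (i < j)%N -> m (b j) < m (b i).

Definition target (k : 'I_M) : 'I_N := b (widen_ord hMN k).

(* An infimum over a finite set, nonempty as soon as 1 < N: a minimum. *)
Definition Delta_min : R :=
  inf [set `|m ij.1 - m ij.2| | ij in [set ij : 'I_N * 'I_N | ij.1 != ij.2]].

(* 1 if [k] is the only agent to sample the arm [i], 0 otherwise; [c] gives the
   selections of the agents at a fixed time. *)
Definition sole_sampler (c : 'I_M -> 'I_N) (i : 'I_N) (k : 'I_M) : R :=
  ((c k == i) && [forall j, (j != k) ==> (c j != i)])%:R.

Context (d : measure_display) (Omega : measurableType d).
Variables (Pr : probability Omega R) (T : nat).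
Variable r : 'I_N -> 'I_M -> nat -> {RV Pr >-> R}.
Variable a : 'I_M -> nat -> Omega -> 'I_N.

Definition regret (k : 'I_M) : \bar R :=
  (\sum_(1 <= t < T.+1)
     ((m (target k))%:E -
      'E_Pr[fun w => (\sum_(i < N) r i k t w * (a k t w == i)%:R *
                        sole_sampler (fun j => a j t w) i k)%R]))%E.

Definition group_regret : \bar R :=
  ((T%:R * \sum_(k < M) m (target k))%R%:E -
   'E_Pr[fun w => (\sum_(1 <= t < T.+1) \sum_(k < M)
                     m (a k t w) *
                     sole_sampler (fun j => a j t w) (a k t w) k)%R])%E.

End Regret.

Section Bound.
Variables (R : realType) (M N : nat) (lam : 'I_M -> R) (u : 'I_M -> 'cV[R]_M).
Variables (sg gamma eta t0 : R) (f : R -> R).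

Definition t_dagger (k : 'I_M) : R := f_inv t0 f (eps_c lam u k).

Definition L_bar : R :=
  \sum_(k < M) (t_dagger k - 1) + M%:R * (1 + eps_n lam) + 1 +
  2 * M%:R * (N%:R + 1) / ln (1 + eta) *
    (1 / (gamma - 1) ^+ 2 +
     gamma * ln ((1 + eps_n lam) * (1 + eta)) / (gamma - 1) + 1).

Definition B_bound (m : 'I_N -> R) (T : nat) : R :=
  let D := Delta_min m in let G := G_eta eta in
  4 * sg ^+ 2 * gamma / (D ^+ 2 * G) *
    (1 + Num.sqrt (1 + D ^+ 2 * M%:R * G / (2 * sg ^+ 2 * gamma) *
                       (f T%:R / ln T%:R))) *
    ln T%:R + L_bar.

End Bound.

(* Main.v *)
Require Import Defs.
From HB Require Import structures.
From mathcomp Require Import all_boot all_order all_algebra all_fingroup.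
From mathcomp Require Import all_classical all_reals all_analysis.
From mathcomp Require Import measurable_realfun.
From mathcomp Require Import ring lra zify.

Set Implicit Arguments.
Unset Strict Implicit.
Unset Printing Implicit Defensive.

Import Order.TTheory GRing.Theory Num.Theory.
Import numFieldNormedType.Exports.

Local Open Scope classical_set_scope.
Local Open Scope ring_scope.

(** Nonnegative means make the regret a matter of counting. A round costs an
    agent at most the best mean when it misses its target, and the mean of its
    target when another agent intrudes there; both are charged to a pull of some
    arm [i] by an agent whose target is not [i] ([round_loss_le]). It therefore
    suffices that the expected number of such pulls of each arm is at most [B]
    ([expected_wrong_pulls_le]). The two regrets compared first are in fact equal,
    because selections are independent of the rewards they reveal ([sum_regret]).

    A wrong pull of arm [i] by agent [k] after round [n] is of one of three kinds
    ([wrong_pulls_le]). Either the group still has few pulls of [i]: such pulls make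
    up for their own shortage, and their number is at most the leading term plus
    [M * (1 + eps_n)]. Or the round is early: [n < N + 2 * M], when an
    agent may not have heard of some arm, or [n < t_dagger k], when [f n] does not
    yet dominate the centrality index. Or the bonus of [i] is below half the
    smallest gap between means; then choosing [i] requires one of [N + 1]
    estimates to be off by more than its bonus, each on a prescribed side
    ([selective_choice_deviates]).

    The probability of such a deviation rests on the powers of the consensus
    matrix. The estimate of agent [k] weighs a pull of age [s] by an entry of row
    [k] of [P ^+ s]. Summed over pulls, these weights differ from the group
    average by at most [eps_n] ([consensus_sum_deviation]), and [M] times the sum
    of their squares exceeds their sum by at most [eps_c]
    ([consensus_square_sum_le]); the second bound turns [nhat + f n] into a
    variance proxy. This proxy is random, as it depends on past selections, but
    for deterministic weights the exponential of the centered sum minus its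
    allowance has expectation at most 1 ([expectation_exp_compensated]). The range
    of [nhat + f n], bounded below by 3/4 after the round robin ([nhat_eps_c_ge]),
    is cut into geometric cells, on each of which a fixed tilt loses only the
    factor [G_eta] ([tail_exponent_ge]). There are at most
    [ln (2 * n) / ln (1 + eta) + 1] cells, so a deviation has probability at most
    this number times [n ^- gamma], which is summable.

    Finally the constants: the last term of [L_bar] is about twice what the deviations
    cost, and the surplus pays for the early rounds [n < N + 2 * M]
    ([excess_budget]). *)

(** * Powers of the consensus matrix *)

Section ConsensusMatrix.
Variables (R : realType) (M : nat) (e : rel 'I_M) (kappa : R).
Hypotheses (he : simple_graph e) (hkappa : 0 < kappa <= 1).

Local Notation P := (consensus_matrix e kappa).

Let step_ge0 : 0 <= kappa / (max_degree e)%:R.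
Proof. by case/andP: hkappa => /ltW k0 _; rewrite divr_ge0. Qed.

Lemma consensus_matrix_ge0 x y : 0 <= P x y.
Proof.
have [_ irr] := he; rewrite !mxE.
case: eqVneq => [->|_]; last first.
  by rewrite mulr0n !sub0r mulrN opprK mulr_ge0.
rewrite irr !mulr1n subr0 subr_ge0.
have dd : (degree e y <= max_degree e)%N by rewrite /max_degree leq_bigmax.
have [->|d0] := posnP (max_degree e); first by rewrite invr0 mulr0 mul0r.
rewrite mulrAC ler_pdivrMr ?ltr0n// mul1r.
apply: le_trans (_ : 1 * (max_degree e)%:R <= _); last by rewrite mul1r.
by case/andP: hkappa => /ltW k0 k1; apply: ler_pM; rewrite ?ler0n ?ler_nat.
Qed.

Lemma consensus_matrix_sum x : \sum_y P x y = 1.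
Proof.
under eq_bigr do rewrite !mxE.
rewrite big_split sumrN -mulr_sumr sumrB /=.
rewrite -[X in _ - _ * (_ - X)]natr_sum.
have -> : (\sum_y e x y = degree e x)%N.
  rewrite /degree -sum1_card [RHS]big_mkcond; apply: eq_bigr => y _.
  by rewrite inE; case: (e x y).
rewrite (bigD1 x)//= eqxx big1 ?addr0 => [|y]; last first.
  by rewrite eq_sym => /negbTE ->.
rewrite (bigD1 x)//= eqxx big1 ?addr0 => [|y]; last first.
  by rewrite eq_sym => /negbTE ->.
by rewrite subrr mulr0 subr0.
Qed.

Lemma consensus_matrix_sym x y : P x y = P y x.
Proof.
have [sym _] := he; rewrite !mxE (sym x) (eq_sym x).
by case: eqVneq => [->|].
Qed.

Lemma consensus_matrix_connect (hconn : connected_graph e) x y :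
  connect [rel x y | 0 < P x y] x y.
Proof.
have [_ irr] := he; apply: (connect_sub _ (hconn x y)) => {x y}x y xy.
apply: connect1; rewrite /= !mxE.
have -> : (x == y) = false by apply/eqP => xy'; rewrite xy' irr in xy.
rewrite xy !sub0r mulrN opprK mulr1 divr_gt0//; first by case/andP: hkappa.
rewrite ltr0n (leq_trans _ (leq_bigmax x))// card_gt0.
by apply/set0Pn; exists y; rewrite inE.
Qed.

End ConsensusMatrix.

Section StochasticPowers.
Variables (R : realType) (M : nat) (P : 'M[R]_M).
Hypotheses (P_ge0 : forall x y, 0 <= P x y) (P_sum : forall x, \sum_y P x y = 1).

Lemma expmxSE s x y : (P ^+ s.+1) x y = \sum_z (P ^+ s) x z * P z y.
Proof. by rewrite exprSr -mulmxE mxE. Qed.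

Lemma expmx_ge0 s x y : 0 <= (P ^+ s) x y.
Proof.
elim: s y => [|s IH] y; first by rewrite expr0 -idmxE mxE.
by rewrite expmxSE sumr_ge0// => z _; rewrite mulr_ge0.
Qed.

Lemma expmx_sum s x : \sum_y (P ^+ s) x y = 1.
Proof.
elim: s => [|s IH].
  rewrite (bigD1 x)//= expr0 -idmxE mxE eqxx big1 ?addr0// => y.
  by rewrite mxE eq_sym => /negbTE ->.
under eq_bigr do rewrite expmxSE.
rewrite exchange_big -[RHS]IH /=; apply: eq_bigr => z _.
by rewrite -mulr_sumr P_sum mulr1.
Qed.

End StochasticPowers.

Section Positivity.
Variables (R : realType) (M : nat) (P : 'M[R]_M) (lam : 'I_M -> R).
Variable (u : 'I_M -> 'cV[R]_M).
Hypotheses (P_ge0 : forall x y, 0 <= P x y) (P_sum : forall x, \sum_y P x y = 1).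
Hypotheses (P_sym : forall x y, P x y = P y x).
Hypothesis P_conn : forall x y, connect [rel x y | 0 < P x y] x y.
Hypothesis spec : consensus_spectrum P lam u.

(** The rows of the matrix of eigenvectors are orthonormal because its columns
    are: a one-sided inverse of a square matrix is two-sided. *)
Lemma eigenbasis_unit : \matrix_(k, p) u p k 0 *m (\matrix_(k, p) u p k 0)^T = 1%:M.
Proof.
have [_ orth _ _ _] := spec; apply: mulmx1C; apply/matrixP => p q.
have := congr1 (fun A : 'M[R]_1 => A 0 0) (orth p q); rewrite !mxE mulr1n => <-.
by apply: eq_bigr => k _; rewrite !mxE.
Qed.

Lemma eigenbasis_sum k j : \sum_p u p k 0 * u p j 0 = (k == j)%:R.
Proof.
have := congr1 (fun A : 'M[R]_M => A k j) eigenbasis_unit; rewrite !mxE => <-.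
by apply: eq_bigr => p _; rewrite !mxE.
Qed.

Lemma expmx_eigen s p : P ^+ s *m u p = lam p ^+ s *: u p.
Proof.
have [eig _ _ _ _] := spec.
elim: s => [|s IH]; first by rewrite !expr0 mul1mx scale1r.
by rewrite exprSr -mulmxE -mulmxA eig -scalemxAr IH scalerA -exprS.
Qed.

Lemma expmx_spectral s k j :
  (P ^+ s) k j = \sum_p lam p ^+ s * (u p k 0 * u p j 0).
Proof.
have -> : (P ^+ s) k j = \sum_l (P ^+ s) k l * (l == j)%:R.
  rewrite (bigD1 j)//= eqxx mulr1 big1 ?addr0// => l /negbTE ->.
  by rewrite mulr0.
under eq_bigr do rewrite -eigenbasis_sum mulr_sumr.
rewrite exchange_big; apply: eq_bigr => p _ /=.
have := congr1 (fun A : 'cV[R]_M => A k 0) (expmx_eigen s p); rewrite !mxE => E.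
by rewrite mulrA -E mulr_suml; apply: eq_bigr => l _; rewrite mulrA.
Qed.

Let nbr x : exists y, 0 < P x y.
Proof.
apply/existsP; apply: contraT; rewrite negb_exists => /forallP H.
have := P_sum x; rewrite big1 => [/esym/eqP|y _]; first by rewrite oner_eq0.
by apply/eqP; move: (H y); rewrite lt_def P_ge0 andbT negbK.
Qed.

Let expmx_gt0S s x y z : 0 < (P ^+ s) x y -> 0 < P y z -> 0 < (P ^+ s.+1) x z.
Proof.
move=> xy yz; rewrite expmxSE (bigD1 y)//= ltr_pwDl ?mulr_gt0//.
by apply: sumr_ge0 => t _; rewrite mulr_ge0//; exact: expmx_ge0.
Qed.

(** The least fixpoint of [even_step k] is the set of nodes that walks of even
    length reach from [k]; [fixset] iterates it [M] times, which is where the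
    exponent [2 (M - 1)] of [expmx_gt0] comes from. *)
Let even_step (k : 'I_M) (E : {set 'I_M}) : {set 'I_M} :=
  k |: [set z | [exists x in E, [exists y, (0 < P x y) && (0 < P y z)]]].

Let even_step_mono k : {homo even_step k : A B / A \subset B}.
Proof.
move=> A B AB; apply: finset.setUS; apply/fintype.subsetP => z; rewrite !inE.
case/exists_inP => x xA xz; apply/exists_inP; exists x => //.
exact: (fintype.subsetP AB).
Qed.

Let iter_even_step k j z : z \in iter j.+1 (even_step k) finset.set0 -> 0 < (P ^+ (j.*2)) k z.
Proof.
elim: j z => [|j IH] z.
  rewrite /= !inE => /orP[/eqP->|/exists_inP[x]]; last by rewrite inE.
  by rewrite expr0 -idmxE mxE eqxx.
rewrite iterS !inE => /orP[/eqP->|/exists_inP[x xi /existsP[y /andP[xy yz]]]].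
  elim: j.+1 => [|i Hi]; first by rewrite expr0 -idmxE mxE eqxx.
  have [y ky] := nbr k; rewrite doubleS; apply: expmx_gt0S (_ : 0 < P y k).
    exact: expmx_gt0S Hi ky.
  by rewrite P_sym.
by rewrite doubleS; apply: expmx_gt0S yz; apply: expmx_gt0S xy; exact: IH.
Qed.

(** Even walks from [k] stay trapped in a proper set of nodes only if the edges
    of positive weight form a bipartite graph; then the signed indicator of the
    two classes is an eigenvector for -1, which the spectrum excludes. Once an
    even power has a positive row, so has every later power, as each node has a
    neighbour. *)
Lemma expmx_gt0 s k z0 : (M.-1.*2 <= s)%N -> 0 < (P ^+ s) k z0.
Proof.
suff pos y : 0 < (P ^+ M.-1.*2) k y.
  move=> /subnK <-; elim: (s - _)%N z0 => [|i Hi] z; first exact: pos.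
  have [y zy] := nbr z; rewrite addSn; apply: expmx_gt0S (Hi y) _.
  by rewrite P_sym.
pose E := fixset (even_step k).
have EK : even_step k E = E by apply: fixsetK; exact: even_step_mono.
have kE : k \in E by rewrite -EK !inE eqxx.
have E2 x z1 z2 : x \in E -> 0 < P x z1 -> 0 < P z1 z2 -> z2 \in E.
  move=> xE xy yz; rewrite -EK !inE; apply/orP; right.
  by apply/exists_inP; exists x => //; apply/existsP; exists z1; rewrite xy.
suff yE : y \in E.
  apply: iter_even_step; rewrite prednK; last exact: leq_trans (ltn_ord k).
  by rewrite -[X in iter X]card_ord.
have spread (D : pred 'I_M) : (forall x z, D x -> 0 < P x z -> D z) ->
    forall x z, D x -> D z.
  move=> HD x x' Dx; case/connectP: (P_conn x x') => p pp ->.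
  elim: p x Dx pp => //= x1 p IH x Dx /andP[xx1 pp].
  by apply: IH pp; exact: HD xx1.
apply: contraT => yE.
have inner x z : x \in E -> 0 < P x z -> z \notin E.
  move=> xE xz; apply: contra yE => zE.
  suff /andP[] : [pred x | (x \in E) && [exists z in E, 0 < P x z]] y by [].
  apply: (spread _ _ x) => [x1 x2|]; last first.
    by rewrite /= xE; apply/exists_inP; exists z.
  case/andP=> x1E /exists_inP[x3 x3E x13] x12 /=.
  have x21 : 0 < P x2 x1 by rewrite P_sym.
  rewrite (E2 x3 x1) ?(P_sym x3)//; apply/exists_inP; by exists x1.
have outer x z : x \notin E -> 0 < P x z -> z \in E.
  move=> xE xz; apply: contraT => zE.
  suff : [pred x | (x \notin E) && [exists z, (z \notin E) && (0 < P x z)]] k.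
    by rewrite /= kE.
  apply: (spread _ _ x) => [x1 x2|]; last first.
    by rewrite /= xE; apply/existsP; exists z; rewrite zE.
  case/andP=> x1E /existsP[x3 /andP[x3E x13]] x12 /=.
  have x21 : 0 < P x2 x1 by rewrite P_sym.
  apply/andP; split; last by apply/existsP; exists x1; rewrite x1E.
  by apply: contra x3E => x2E; exact: E2 x21 x13.
(* the two classes of a bipartition carry an eigenvector for -1 *)
pose v x : R := if x \in E then 1 else -1.
have Pv x : \sum_z P x z * v z = - v x.
  rewrite -[RHS]mul1r -(P_sum x) mulr_suml; apply: eq_bigr => z' _.
  have [xz|] := boolP (0 < P x z'); last first.
    by rewrite lt_def P_ge0 andbT negbK => /eqP->; rewrite !mul0r.
  congr (_ * _); rewrite /v; have [xE|xE] := boolP (x \in E).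
    by rewrite (negbTE (inner _ _ xE xz)).
  by rewrite (outer _ _ xE xz) opprK.
have [eig _ _ _ [_ lamN1]] := spec.
have c0 p : \sum_x u p x 0 * v x = 0.
  set c := \sum_x _; suff : (lam p + 1) * c = 0.
    by move/eqP; rewrite mulf_eq0 => /orP[/eqP L|/eqP//]; have := lamN1 p; lra.
  rewrite mulrDl mul1r; apply/eqP; rewrite addr_eq0; apply/eqP.
  rewrite /c mulr_sumr -sumrN.
  under [RHS]eq_bigr do rewrite -mulrN -Pv mulr_sumr.
  rewrite exchange_big; apply: eq_bigr => x _ /=.
  have := congr1 (fun A : 'cV[R]_M => A x 0) (eig p); rewrite !mxE => H.
  rewrite mulrA -H mulr_suml; apply: eq_bigr => t _.
  by rewrite (P_sym t); ring.
have : v k = 0.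
  transitivity (\sum_x (k == x)%:R * v x).
    rewrite (bigD1 k)//= eqxx mul1r big1 ?addr0// => x.
    by rewrite eq_sym => /negbTE ->; rewrite mul0r.
  under eq_bigr do rewrite -eigenbasis_sum mulr_suml.
  rewrite exchange_big big1// => p _ /=.
  under eq_bigr do rewrite -mulrA.
  by rewrite -mulr_sumr c0 mulr0.
by rewrite /v kE => /eqP; rewrite oner_eq0.
Qed.

End Positivity.

(** * Explore-exploit indices as bounds on consensus weights *)

Lemma geometric_tail_le (R : realType) (q : R) n : 0 <= q < 1 ->
  \sum_(s < n) q ^+ s.+1 <= q / (1 - q).
Proof.
move=> /andP[q0 q1]; rewrite ler_pdivlMr ?subr_gt0//.
suff -> : (\sum_(s < n) q ^+ s.+1) * (1 - q) = q * (1 - q ^+ n).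
  by rewrite ler_piMr// lerBlDr lerDl exprn_ge0.
elim: n => [|n IH]; first by rewrite big_ord0 mul0r expr0 subrr mulr0.
by rewrite big_ord_recr /= mulrDl IH !exprS; ring.
Qed.

Section ExploreExploit.
Variables (R : realType) (M : nat) (P : 'M[R]_M) (lam : 'I_M -> R).
Variable (u : 'I_M -> 'cV[R]_M).
Hypotheses (P_ge0 : forall x y, 0 <= P x y) (P_sum : forall x, \sum_y P x y = 1).
Hypothesis spec : consensus_spectrum P lam u.

Let M_gt0 (k : 'I_M) : (0 < M)%N. Proof. exact: leq_trans (ltn_ord k). Qed.

Lemma abs_eigenvalue_lt1 (p : 'I_M) : (0 < p)%N -> `|lam p| < 1.
Proof.
have [_ _ _ l1 [_ lN1]] := spec => p0; rewrite ltr_norml lN1 andTb; exact: l1.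
Qed.

Lemma abs_eigenvalue_le1 (p : 'I_M) : `|lam p| <= 1.
Proof.
have [p0|p0] := ltnP 0 p; first exact/ltW/abs_eigenvalue_lt1.
have [_ _ /(_ p) H _ _] := spec.
have [|-> _] := H; last by rewrite normr1.
by apply/eqP; rewrite -leqn0.
Qed.

Lemma eigenvector_sqr_sum p : \sum_k u p k 0 ^+ 2 = 1.
Proof.
have [_ orth _ _ _] := spec.
have := congr1 (fun A : 'M[R]_1 => A 0 0) (orth p p).
rewrite !mxE !eqxx /= !mulr1n => <-; apply: eq_bigr => k _; by rewrite !mxE expr2.
Qed.

Lemma eigenvector_le1 p k : `|u p k 0| <= 1.
Proof.
rewrite -[leRHS]ger0_norm// -ler_sqr ?nnegrE// !real_normK ?num_real// expr1n.
rewrite -(eigenvector_sqr_sum p) (bigD1 k)//= lerDl.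
by apply: sumr_ge0 => j _; rewrite sqr_ge0.
Qed.

(** Cauchy-Schwarz against the constant vector, obtained by averaging
    [2 |u_d| <= sqrt M * u_d ^ 2 + 1 / sqrt M] over [d]. *)
Lemma eigenvector_dot_le p (y : 'I_M -> R) : (forall k, 0 <= y k <= 1) ->
  `|\sum_k u p k 0 * y k| <= Num.sqrt M%:R.
Proof.
move=> y01; have M0 : 0 < M%:R :> R by rewrite ltr0n (M_gt0 p).
set q := Num.sqrt M%:R; have q0 : 0 < q by rewrite sqrtr_gt0.
have qq : q ^+ 2 = M%:R by rewrite sqr_sqrtr// ltW.
apply: le_trans (ler_norm_sum _ _ _) _.
apply: (@le_trans _ _ (\sum_k (q * u p k 0 ^+ 2 + q^-1) / 2)).
  apply: ler_sum => k _; rewrite normrM.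
  apply: (@le_trans _ _ `|u p k 0|).
    by rewrite ler_piMr// ger0_norm; case/andP: (y01 k).
  rewrite ler_pdivlMr// -subr_ge0 -(pmulr_rge0 _ q0).
  have -> : q * (q * u p k 0 ^+ 2 + q^-1 - `|u p k 0| * 2) = (q * `|u p k 0| - 1) ^+ 2.
    have : `|u p k 0| ^+ 2 = u p k 0 ^+ 2 by rewrite real_normK ?num_real.
    move=> <-; field; exact: lt0r_neq0.
  exact: sqr_ge0.
rewrite -mulr_suml big_split -mulr_sumr eigenvector_sqr_sum /= sumr_const card_ord.
rewrite mulr1 -[q^-1 *+ M]mulr_natr -qq ler_pdivrMr// expr2 mulKf ?lt0r_neq0//.
by rewrite mulr2n mulrDr mulr1.
Qed.

Let first_spectral (p0 k j : 'I_M) : p0 = 0%N :> nat ->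
  lam p0 = 1 /\ u p0 k 0 * u p0 j 0 = M%:R^-1.
Proof.
move=> h; have [_ _ /(_ p0 h)[-> ->] _ _] := spec; split=> //.
by rewrite !mxE -invfM -expr2 sqr_sqrtr.
Qed.

(** The first eigenvector contributes exactly the average [1 / M]. *)
Lemma expmx_deviation s k j : (P ^+ s) k j =
  M%:R^-1 + \sum_(p < M | (0 < p)%N) lam p ^+ s * (u p k 0 * u p j 0).
Proof.
pose p0 := Ordinal (M_gt0 k).
rewrite (expmx_spectral spec) (bigD1 p0)//=.
have [-> ->] := @first_spectral p0 k j erefl; rewrite expr1n mul1r; congr (_ + _).
by apply: eq_bigl => p; rewrite lt0n.
Qed.

(** What agent [k] holds of a signal [x] injected over time, with [s] the age of
    each injection, tracks the group average of the signal: every other eigenvalue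
    contributes a geometric series. *)
Lemma consensus_sum_deviation n k (x : nat -> 'I_M -> R) :
  (forall s j, 0 <= x s j <= 1) ->
  `|\sum_(s < n) \sum_j (P ^+ s.+1) k j * x s j
    - M%:R^-1 * \sum_(s < n) \sum_j x s j| <= eps_n lam.
Proof.
move=> x01; rewrite mulr_sumr -sumrB.
pose D (s : nat) (p : 'I_M) := lam p ^+ s.+1 * (u p k 0 * \sum_j u p j 0 * x s j).
have -> : \sum_(s < n) (\sum_j (P ^+ s.+1) k j * x s j - M%:R^-1 * \sum_j x s j)
    = \sum_(p < M | (0 < p)%N) \sum_(s < n) D s p.
  rewrite exchange_big; apply: eq_bigr => s _ /=.
  under eq_bigr do rewrite expmx_deviation mulrDl.
  rewrite big_split -mulr_sumr /= addrAC subrr add0r.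
  under eq_bigr do rewrite mulr_suml.
  rewrite exchange_big; apply: eq_bigr => p _ /=.
  by rewrite /D !mulr_sumr; apply: eq_bigr => j _; ring.
apply: le_trans (ler_norm_sum _ _ _) _; rewrite /eps_n mulr_sumr.
apply: ler_sum => p p0; apply: le_trans (ler_norm_sum _ _ _) _.
have l0 := normr_ge0 (lam p); have l1 := abs_eigenvalue_lt1 p0.
apply: (@le_trans _ _ (\sum_(s < n) Num.sqrt M%:R * `|lam p| ^+ s.+1)).
  apply: ler_sum => s _; rewrite /D normrM normrX mulrC ler_wpM2r ?exprn_ge0//.
  rewrite normrM -[leRHS]mul1r ler_pM//; first exact: eigenvector_le1.
  exact: eigenvector_dot_le.
rewrite -mulr_sumr ler_wpM2l ?sqrtr_ge0// geometric_tail_le//.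
by rewrite l0 l1.
Qed.

Lemma eps_n_ge0 : 0 <= eps_n lam.
Proof.
rewrite mulr_ge0 ?sqrtr_ge0//; apply: sumr_ge0 => p p0.
by rewrite divr_ge0// subr_ge0 ltW// abs_eigenvalue_lt1.
Qed.

Local Notation uu p j k := (u p k 0 * u j k 0).

Let nu_psum_ge0 p j : 0 <= nu_psum u p j.
Proof. by rewrite /nu_psum sumr_ge0. Qed.

Let nu_nsum_le0 p j : nu_nsum u p j <= 0.
Proof. by rewrite /nu_nsum sumr_le0. Qed.

Let nu_bounds p j (y : 'I_M -> R) : (forall k, 0 <= y k <= 1) ->
  nu_nsum u p j <= \sum_k uu p j k * y k <= nu_psum u p j.
Proof.
move=> y01; rewrite /nu_nsum /nu_psum; apply/andP; split.
- rewrite big_mkcond /=; apply: ler_sum => k _; have /andP[y0 y1] := y01 k.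
  case: ifPn => [h|]; first by rewrite ler_niMr.
  by rewrite -ltNge => /ltW h; rewrite mulr_ge0.
- rewrite [leRHS]big_mkcond /=; apply: ler_sum => k _; have /andP[y0 y1] := y01 k.
  case: ifPn => [h|]; first by rewrite ler_piMr.
  by rewrite -ltNge => /ltW h; rewrite mulr_le0_ge0.
Qed.

Let a_coef_ge0 p j k : 0 <= a_coef lam u p j k.
Proof.
rewrite /a_coef; case: ifP => _; last first.
  by rewrite mulr_ge0// le_max normr_ge0.
case: ifPn => h; first by rewrite mulr_ge0.
by rewrite mulr_le0// ltW// ltNge.
Qed.

Let spectral_term_le p j k s (y : 'I_M -> R) : (forall k, 0 <= y k <= 1) ->
  (lam p * lam j) ^+ s * (uu p j k * \sum_d uu p j d * y d)
  <= `|lam p * lam j| ^+ s * a_coef lam u p j k.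
Proof.
move=> /(nu_bounds p j) /andP[]; set X := \sum_d _ => X1 X2.
rewrite /a_coef; case: ifPn => [l0|l0].
  rewrite ger0_norm// ler_wpM2l ?exprn_ge0//.
  case: ifPn => [h|]; first by rewrite [leRHS]mulrC ler_wpM2l.
  by rewrite -ltNge => /ltW h; rewrite [leRHS]mulrC ler_wnM2l.
apply: le_trans (ler_norm _) _; rewrite normrM normrX ler_wpM2l ?exprn_ge0//.
rewrite normrM [leRHS]mulrC ler_wpM2l// /nu_max.
have [X0|X0] := lerP 0 X; first by rewrite ger0_norm// le_max X2 orbT.
rewrite le_max; apply/orP; left; rewrite !ler0_norm// ?(ltW X0)//.
by rewrite lerN2.
Qed.

(** The weighted sum of squares is what controls the variance of the estimates.
    Expanding one of the two factors as in [expmx_deviation], its [1 / M] part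
    gives back the linear sum, and the rest is summed pair of eigenvalues by pair
    of eigenvalues; [a_coef] bounds the resulting coefficient over signals with
    values in [[0, 1]]. *)
Lemma consensus_square_sum_le n k (x : nat -> 'I_M -> R) :
  (forall s j, 0 <= x s j <= 1) ->
  M%:R * \sum_(s < n) \sum_j (P ^+ s.+1) k j ^+ 2 * x s j
  <= \sum_(s < n) \sum_j (P ^+ s.+1) k j * x s j + eps_c lam u k.
Proof.
move=> x01; have M0 : M%:R != 0 :> R by rewrite pnatr_eq0 -lt0n (M_gt0 k).
pose D (s : nat) (p j : 'I_M) :=
  (lam p * lam j) ^+ s.+1 * (uu p j k * \sum_d uu p j d * x s d).
have -> : \sum_(s < n) \sum_d (P ^+ s.+1) k d ^+ 2 * x s d =
    M%:R^-1 * (\sum_(s < n) \sum_j (P ^+ s.+1) k j * x s j) +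
    \sum_(p < M) \sum_(j < M | (0 < j)%N) \sum_(s < n) D s p j.
  under [X in _ = _ + X]eq_bigr do rewrite exchange_big /=.
  rewrite [X in _ = _ + X]exchange_big mulr_sumr -big_split /=.
  apply: eq_bigr => s _.
  have -> : \sum_(p < M) \sum_(j < M | (0 < j)%N) D s p j =
      \sum_d (P ^+ s.+1) k d *
        (\sum_(j < M | (0 < j)%N) lam j ^+ s.+1 * (u j k 0 * u j d 0)) * x s d.
    under [RHS]eq_bigr do rewrite (expmx_spectral spec) !mulr_suml.
    rewrite [RHS]exchange_big; apply: eq_bigr => p _ /=.
    under [RHS]eq_bigr do rewrite mulr_sumr mulr_suml.
    rewrite [RHS]exchange_big; apply: eq_bigr => j _ /=.
    by rewrite /D !mulr_sumr; apply: eq_bigr => d _; rewrite exprMn; ring.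
  rewrite mulr_sumr -big_split /=; apply: eq_bigr => d _.
  rewrite expr2 {2}expmx_deviation; ring.
rewrite mulrDr mulVKf// lerD2l /eps_c ler_wpM2l ?ler0n//.
apply: ler_sum => p _; apply: ler_sum => j j0.
apply: (@le_trans _ _ (\sum_(s < n) `|lam p * lam j| ^+ s.+1 * a_coef lam u p j k)).
  by apply: ler_sum => s _; exact: spectral_term_le.
rewrite -mulr_suml ler_wpM2r ?a_coef_ge0// geometric_tail_le//.
rewrite normr_ge0 normrM /=.
apply: le_lt_trans (abs_eigenvalue_lt1 j0); rewrite ler_piMl//.
exact: abs_eigenvalue_le1.
Qed.

Lemma eps_c_ge0 k : 0 <= eps_c lam u k.
Proof.
have := @consensus_square_sum_le 0 k (fun _ _ => 0).
by rewrite !big_ord0 mulr0 add0r; apply=> ? ?; rewrite lexx ler01.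
Qed.

(** A signal that every agent has injected once, at pairwise distinct ages,
    cannot have been lost both in the estimate and in the index of [k]. Applied
    to the signal in which all agents inject at all of these ages,
    [consensus_square_sum_le] makes [eps_c] at least
    [\sum_j (M * \sum_i w_i ^ 2 - 1)], where [w] is the weight row at the age of [j].
    With [y = w_j - 1 / M], each term of the total is then at least
    [1 / M + y + M * y ^ 2 >= 3 / (4 * M)]. *)
Lemma staggered_weight_ge n k (x : nat -> 'I_M -> R) (age : 'I_M -> nat) :
  (forall s j, 0 <= x s j <= 1) -> injective age ->
  (forall j, (age j < n)%N) -> (forall j, x (age j) j = 1) ->
  3 / 4 <= \sum_(s < n) \sum_j (P ^+ s.+1) k j * x s j + eps_c lam u k.
Proof.
move=> x01 inj_age age_lt x1.
have M0 : 0 < M%:R :> R by rewrite ltr0n (M_gt0 k).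
(* all agents inject at every age that occurs *)
pose y (s : nat) (_ : 'I_M) : R := [exists j, age j == s]%:R.
have y01 s j : 0 <= y s j <= 1 by rewrite ler0n lern1 leq_b1.
have sumy (F : nat -> R) : \sum_(s < n) F s * y s k = \sum_j F (age j).
  transitivity (\sum_(s < n) \sum_(j < M) F s * (age j == s)%:R).
    apply: eq_bigr => s _; rewrite -mulr_sumr; congr (_ * _); rewrite /y.
    case: existsP => [[j /eqP js]|nex].
      rewrite (bigD1 j)//= js eqxx big1 ?addr0// => j' jj'.
      by rewrite -js (inj_eq inj_age) (negbTE jj').
    by rewrite big1// => j _; case: eqP => // js; case: nex; exists j; apply/eqP.
  rewrite exchange_big; apply: eq_bigr => j _ /=.
  rewrite (bigD1 (Ordinal (age_lt j)))//= eqxx mulr1 big1 ?addr0// => s.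
  by rewrite -val_eqE /= eq_sym => /negbTE->; rewrite mulr0.
have Hc : M%:R * \sum_j \sum_i (P ^+ (age j).+1) k i ^+ 2
    <= M%:R + eps_c lam u k.
  have := consensus_square_sum_le n k y01.
  under eq_bigr do rewrite -mulr_suml.
  under [in X in _ <= X -> _]eq_bigr do rewrite -mulr_suml (expmx_sum P_sum).
  rewrite (sumy (fun s => \sum_i (P ^+ s.+1) k i ^+ 2)) (sumy (fun=> 1)).
  by rewrite sumr_const card_ord.
have Hx : \sum_j (P ^+ (age j).+1) k j <=
    \sum_(s < n) \sum_j (P ^+ s.+1) k j * x s j.
  rewrite exchange_big; apply: ler_sum => j _ /=.
  rewrite (bigD1 (Ordinal (age_lt j)))//= x1 mulr1 lerDl sumr_ge0// => s _.
  by rewrite mulr_ge0 ?expmx_ge0//; case/andP: (x01 s j).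
have cell j : 3 / 4 * M%:R^-1 <= (P ^+ (age j).+1) k j - 1
    + M%:R * \sum_i (P ^+ (age j).+1) k i ^+ 2.
  pose w i := (P ^+ (age j).+1) k i.
  have var : M%:R * \sum_i w i ^+ 2 - 1 = M%:R * \sum_i (w i - M%:R^-1) ^+ 2.
    have -> : \sum_i (w i - M%:R^-1) ^+ 2 =
        \sum_i w i ^+ 2 - 2 * M%:R^-1 * \sum_i w i + \sum_(i < M) M%:R^-1 ^+ 2.
      by rewrite mulr_sumr -sumrB -big_split; apply: eq_bigr => i _ /=; ring.
    rewrite (expmx_sum P_sum) sumr_const card_ord -[_ *+ M]mulr_natl.
    by field; exact: lt0r_neq0.
  have : (w j - M%:R^-1) ^+ 2 <= \sum_i (w i - M%:R^-1) ^+ 2.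
    by rewrite (bigD1 j)//= lerDl sumr_ge0// => i _; rewrite sqr_ge0.
  move=> le_sq; have H := ler_wpM2l (ltW M0) le_sq; rewrite -var in H.
  apply: (@le_trans _ _ (w j + M%:R * (w j - M%:R^-1) ^+ 2)); last first.
    by rewrite /w in H *; lra.
  rewrite -subr_ge0.
  have -> : w j + M%:R * (w j - M%:R^-1) ^+ 2 - 3 / 4 * M%:R^-1 =
      M%:R * (w j - M%:R^-1 / 2) ^+ 2 by field; exact: lt0r_neq0.
  by rewrite mulr_ge0 ?sqr_ge0 ?ler0n.
have : \sum_(j < M) 3 / 4 * M%:R^-1 <= \sum_j ((P ^+ (age j).+1) k j - 1
    + M%:R * \sum_i (P ^+ (age j).+1) k i ^+ 2) by apply: ler_sum => j _; exact: cell.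
rewrite sumr_const card_ord -[_ *+ M]mulr_natl mulrCA divff ?lt0r_neq0// mulr1.
by rewrite big_split sumrB -mulr_sumr /= sumr_const card_ord; lra.
Qed.

End ExploreExploit.

(** * An exponential supermartingale for adaptive sampling *)

Import HBNNSimple.

Section FactorizedIntegrals.
Context (R : realType) (d : measure_display) (Omega : measurableType d).
Variable Pr : probability Omega R.

(** If [H] and [X] factorize on indicators of [X], they factorize on every
    nonnegative function of [X], by monotone approximation with simple functions. *)
Lemma integral_factor d' (T' : measurableType d') (H : Omega -> R)
    (X : Omega -> T') (g : T' -> R) (c : R) :
  measurable_fun setT H -> (forall w, 0 <= H w) -> measurable_fun setT X ->
  measurable_fun setT g -> (forall y, 0 <= g y) ->
  (forall A, measurable A ->
    (\int[Pr]_w (H w * \1_A (X w))%:E = c%:E * Pr (X @^-1` A))%E) ->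
  (\int[Pr]_w (H w * g (X w))%:E = c%:E * \int[Pr]_w (g (X w))%:E)%E.
Proof.
move=> mH H0 mX mg g0 Hc.
have mgE : measurable_fun [set: T'] (fun y => (g y)%:E) by exact/measurable_EFinP.
pose h := @nnsfun_approx _ T' R setT measurableT (fun y => (g y)%:E) mgE.
have mhX n : measurable_fun setT (fun w => h n (X w)).
  exact: (measurableT_comp (measurable_funPT (h n)) mX).
have ndh x : {homo (fun n => h n x) : n m / (n <= m)%N >-> n <= m}.
  by move=> n m nm; exact/lefP/nd_nnsfun_approx.
have hcvg (x : T') : (h n x)%:E @[n --> \oo] --> (g x)%:E.
  have gE0 y : [set: T'] y -> (0 <= (g y)%:E)%E.
    by move=> _; rewrite lee_fin.
  exact: (cvg_nnsfun_approx measurableT mgE gE0 (x := x) I).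
have h0 n x : 0 <= h n x by [].
have cvgL : (\int[Pr]_w (H w * h n (X w))%:E @[n --> \oo]
             --> \int[Pr]_w (H w * g (X w))%:E)%E.
  have -> : (fun w => (H w * g (X w))%:E) =
            (fun w => limn (fun n => (H w * h n (X w))%:E)).
    apply/funext => w; apply/esym/cvg_lim => //.
    rewrite EFinM; under eq_fun do rewrite EFinM.
    exact/cvgeZl/hcvg.
  apply: cvg_monotone_convergence => //.
  - move=> n; apply/measurable_EFinP; exact: measurable_funM.
  - by move=> n w _; rewrite lee_fin mulr_ge0.
  - by move=> w _ n m nm; rewrite lee_fin ler_wpM2l// ndh.
have cvgR : (\int[Pr]_w (h n (X w))%:E @[n --> \oo]
             --> \int[Pr]_w (g (X w))%:E)%E.
  have -> : (fun w => (g (X w))%:E) = (fun w => limn (fun n => (h n (X w))%:E)).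
    by apply/funext => w; apply/esym/cvg_lim => //; exact: hcvg.
  apply: cvg_monotone_convergence => //.
  - by move=> n; apply/measurable_EFinP.
  - by move=> n w _; rewrite lee_fin.
  - by move=> w _ n m nm; rewrite lee_fin ndh.
apply: (cvg_unique _ cvgL) => //.
suff -> : (fun n => \int[Pr]_w (H w * h n (X w))%:E)%E =
          (fun n => c%:E * \int[Pr]_w (h n (X w))%:E)%E by exact: cvgeZl.
apply/funext => n.
have mhn y : measurable (h n @^-1` [set y]) by exact: measurable_funPTI.
have m1 y : measurable_fun setT (fun w => \1_(h n @^-1` [set y]) (X w) : R).
  exact: (measurableT_comp (measurable_indic (mhn y)) mX).
have -> : (fun w => (h n (X w))%:E) =
    (fun w => \sum_(y \in range (h n)) (y * \1_(h n @^-1` [set y]) (X w))%:E)%E.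
  by apply/funext => w; rewrite fsumEFin// -fimfunE.
have -> : (fun w => (H w * h n (X w))%:E) =
    (fun w => \sum_(y \in range (h n)) (H w * (y * \1_(h n @^-1` [set y]) (X w)))%:E)%E.
  apply/funext => w; rewrite fsumEFin//= {1}(fimfunE (h n) (X w)); congr _%:E.
  by rewrite !fsbig_finite//= mulr_sumr.
rewrite !ge0_integral_fsum//; last 4 first.
- move=> y; apply/measurable_EFinP; apply: measurable_funM => //.
- by move=> y w _; exact: nnfun_muleindic_ge0.
- move=> y; apply/measurable_EFinP; apply: measurable_funM => //.
  exact: measurable_funM.
- move=> y w _; rewrite EFinM mule_ge0 ?lee_fin//.
  by have := nnfun_muleindic_ge0 (h n) y (X w); rewrite lee_fin.
rewrite !fsbig_finite//= big_seq [in RHS]big_seq ge0_sume_distrr; last first.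
  move=> y _; apply: integral_ge0 => w _; exact: nnfun_muleindic_ge0.
apply: eq_bigr => y; rewrite in_fset_set// inE => -[x _ xy].
have y0 : 0 <= y by rewrite -xy.
under eq_integral do rewrite mulrCA EFinM.
rewrite ge0_integralZl//; last 2 first.
- by apply/measurable_EFinP; exact: measurable_funM.
- by move=> w _; rewrite lee_fin mulr_ge0.
rewrite Hc; last exact: measurable_funPTI.
under [in RHS]eq_integral do rewrite EFinM.
rewrite [in RHS]ge0_integralZl//; last first.
- by apply/measurable_EFinP.
have -> : (fun w => (\1_(h n @^-1` [set y]) (X w))%:E) =
          (fun w => (\1_(X @^-1` (h n @^-1` [set y])) w)%:E) by [].
rewrite integral_indic// ?setIT; first by rewrite muleCA.
rewrite -[X in measurable X]setTI; apply: mX => //; exact: measurable_funPTI.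
Qed.

(** The indicators of the [X i] are replaced by the functions [g i] one at a
    time; the factors already replaced are absorbed into [H]. *)
Lemma integral_factor_prod (I : eqType) (s : seq I) (H : Omega -> R)
    (X : I -> Omega -> R) (g : I -> R -> R) (c : R) (v : I -> R) :
  measurable_fun setT H -> (forall w, 0 <= H w) ->
  (forall i, measurable_fun setT (X i)) ->
  (forall i, measurable_fun setT (g i)) -> (forall i y, 0 <= g i y) ->
  (forall A : I -> set R, (forall i, measurable (A i)) ->
    (\int[Pr]_w (H w * \prod_(i <- s) \1_(A i) (X i w))%:E =
     c%:E * \big[mule/1]_(i <- s) Pr (X i @^-1` A i))%E) ->
  uniq s ->
  (forall i, i \in s -> (\int[Pr]_w (g i (X i w))%:E)%E = (v i)%:E) ->
  (\int[Pr]_w (H w * \prod_(i <- s) g i (X i w))%:E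
   = (c * \prod_(i <- s) v i)%:E)%E.
Proof.
move=> mH H0 mX mg g0; elim: s H mH H0 c => [|i s IH] H mH H0 c Hc us Hv.
  have := Hc (fun=> setT) (fun=> measurableT).
  rewrite [in X in _ = X]big_nil mule1 [in X in _ -> X]big_nil mulr1 => <-.
  by apply: eq_integral => w _; rewrite !big_nil.
have mPX A j : measurable A -> measurable (X j @^-1` A).
  by move=> mA; rewrite -[X in measurable X]setTI; exact: mX.
have mind (A : set R) j : measurable A ->
    measurable_fun setT (fun w => \1_A (X j w) : R).
  by move=> mA; exact: (measurableT_comp (measurable_indic mA) (mX j)).
under eq_integral do rewrite big_cons mulrA.
rewrite big_cons mulrA; case/andP: us => si us.
apply: (IH (fun w => H w * g i (X i w))) => //.
- exact: (measurable_funM mH (measurableT_comp (mg i) (mX i))).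
- by move=> w; rewrite mulr_ge0.
- move=> A mA.
  pose K w := H w * \prod_(j <- s) \1_(A j) (X j w).
  pose p := (\big[mule/1]_(j <- s) Pr (X j @^-1` A j))%E.
  have pfin : p \is a fin_num.
    rewrite /p; elim: (s) => [|j l ih]; first by rewrite big_nil.
    by rewrite big_cons fin_numM// fin_num_measure//; exact: mPX.
  have mK : measurable_fun setT K.
    by apply: measurable_funM => //; apply: measurable_prod => j _; exact: mind.
  have K0 w : 0 <= K w.
    by rewrite mulr_ge0//; apply: prodr_ge0 => j _; rewrite indicE ler0n.
  have KB (B : set R) : measurable B ->
      (\int[Pr]_w (K w * \1_B (X i w))%:E = (c * fine p)%:E * Pr (X i @^-1` B))%E.
    move=> mB; have E (T : Type) (idx : T) op (F1 : I -> set R -> T) :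
        \big[op/idx]_(j <- s) F1 j (if j == i then B else A j) =
        \big[op/idx]_(j <- s) F1 j (A j).
      apply: eq_big_seq => j js; case: eqVneq => // ji.
      by rewrite -ji js in si.
    have := Hc (fun j => if j == i then B else A j).
    rewrite [in X in _ = X]big_cons eqxx (E _ _ _ (fun j B => Pr (X j @^-1` B))).
    rewrite EFinM fineK// -muleA [(p * _)%E]muleC => <-.
      apply: eq_integral => w _; rewrite big_cons eqxx.
      by rewrite (E _ _ _ (fun j B => \1_B (X j w))) [in RHS]mulrCA mulrC.
    by move=> j; case: ifP.
  have := integral_factor mK K0 (mX i) (mg i) (g0 i) KB.
  rewrite Hv ?mem_head// EFinM fineK// => F.
  rewrite EFinM -muleA [(_ * p)%E]muleC muleA -F.
  by apply: eq_integral => w _; congr _%:E; rewrite mulrAC.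
- by move=> j js; apply: Hv; rewrite inE js orbT.
Qed.

End FactorizedIntegrals.

Lemma le_expR_of_lne (R : realType) (x : \bar R) (y : R) :
  (lne x <= y%:E)%E -> (x <= (expR y)%:E)%E.
Proof.
case: x => [x| |] //=; last by rewrite !leNye.
case: ifPn => [x0 _|]; first by rewrite lee_fin (le_trans x0)// expR_ge0.
by rewrite -ltNge !lee_fin => x0 xy; rewrite -(lnK x0) ler_expR.
Qed.

Lemma prod_indic (R : realType) (T : Type) (I : choiceType) (s : seq I)
    (F : I -> set T) (w : T) :
  \prod_(i <- s) \1_(F i) w = \1_(\bigcap_(i in [set` s]) F i) w :> R.
Proof.
rewrite bigcap_seq; elim: s => [|i s IH]; first by rewrite !big_nil indicT.
by rewrite !big_cons IH indicI.
Qed.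

Section ExponentialSupermartingale.
Context (R : realType) (d : measure_display) (Omega : measurableType d).
Variables (Pr : probability Omega R) (M N T : nat).
Variables (r : 'I_N -> 'I_M -> nat -> {RV Pr >-> R}).
Variables (a : 'I_M -> nat -> Omega -> 'I_N) (m : 'I_N -> R) (sg : R).
Hypotheses (ha : random_selections T a) (hr : reward_model T r a m sg).

(** Logarithm of the exponential supermartingale of arm [i] for the deterministic
    weights [c]: each pull adds its centered reward and subtracts the exponent
    that the sub-Gaussian bound allows for. *)
Definition compensated_exponent (i : 'I_N) (c : nat -> 'I_M -> R) (n : nat)
    (w : Omega) : R :=
  \sum_(s < n) \sum_k (a k s.+1 w == i)%:R *
    (c s k * (r (a k s.+1 w) k s.+1 w - m i) - c s k ^+ 2 * sg ^+ 2 / 2).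

(** Naming the generators of [history_before r a t] and [rewards_at r t] gives
    these sigma-algebras a measurable type. *)
Let gen (t : nat) : set (set Omega) :=
  [set A | (exists k s (B : set R), [/\ (0 < s < t)%N, measurable B &
                  A = [set w | B (r (a k s w) k s w)]]) \/
           (exists k s i, (0 < s <= t)%N /\ A = a k s @^-1` [set i])].

Let rgen (t : nat) : set (set Omega) :=
  [set A | exists i k (B : set R), measurable B /\ A = r i k t @^-1` B].

Let measurable_sel i k t : (0 < t <= T)%N ->
  measurable_fun setT (fun w => (a k t w == i)%:R : R).
Proof.
move=> ht; have -> : (fun w => (a k t w == i)%:R) = \1_(a k t @^-1` [set i]) :> (Omega -> R).
  apply/funext => w; rewrite indicE; congr (nat_of_bool _)%:R.
  by apply/eqP/idP; rewrite inE.
exact/measurable_indic/ha.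
Qed.

Let measurable_measurement k t : (0 < t <= T)%N ->
  measurable_fun setT (fun w => r (a k t w) k t w : R).
Proof.
move=> ht; have -> : (fun w => r (a k t w) k t w) =
    (fun w => \sum_i (a k t w == i)%:R * r i k t w) :> (Omega -> R).
  apply/funext => w; rewrite (bigD1 (a k t w))//= eqxx mul1r big1 ?addr0// => i.
  by rewrite eq_sym => /negbTE ->; rewrite mul0r.
apply: measurable_sum => i; apply: measurable_funM; first exact: measurable_sel.
exact: measurable_funP.
Qed.

Let exponent_measurable d' (O : measurableType d') (A : 'I_M -> nat -> O -> 'I_N)
    (Y : 'I_M -> nat -> O -> R) i (c : nat -> 'I_M -> R) n :
  (forall k s, (s < n)%N -> measurable_fun setT (fun w => (A k s.+1 w == i)%:R : R)) ->
  (forall k s, (s < n)%N -> measurable_fun setT (Y k s.+1)) ->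
  measurable_fun setT (fun w => \sum_(s < n) \sum_k (A k s.+1 w == i)%:R *
    (c s k * (Y k s.+1 w - m i) - c s k ^+ 2 * sg ^+ 2 / 2)).
Proof.
move=> hA hY; apply: measurable_sum => s; apply: measurable_sum => k.
apply: measurable_funM; first exact: hA.
apply: measurable_funB => //; apply: measurable_funM => //.
by apply: measurable_funB => //; exact: hY.
Qed.

Lemma measurable_compensated_exponent i c n : (n <= T)%N ->
  measurable_fun setT (compensated_exponent i c n).
Proof.
move=> nT; apply: (exponent_measurable (A := a)
  (Y := fun k s w => r (a k s w) k s w)) => k s sn.
- by apply: measurable_sel; rewrite ltn0Sn (leq_trans sn).
- by apply: measurable_measurement; rewrite ltn0Sn (leq_trans sn).
Qed.

Let history_exponent i c n :
  measurable_fun [set: g_sigma_algebraType (gen n.+1)] (compensated_exponent i c n).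
Proof.
apply: (exponent_measurable (O := g_sigma_algebraType (gen n.+1)) (A := a)
  (Y := fun k s w => r (a k s w) k s w)) => k s sn.
- have -> : (fun w => (a k s.+1 w == i)%:R) = \1_(a k s.+1 @^-1` [set i]) :> (Omega -> R).
    apply/funext => w; rewrite indicE; congr (nat_of_bool _)%:R.
    by apply/eqP/idP; rewrite inE.
  apply: (@measurable_indic _ (g_sigma_algebraType (gen n.+1))).
  apply: sub_sigma_algebra; right; exists k, s.+1, i; split=> //.
  by rewrite ltn0Sn ltnW.
- move=> _ B mB; rewrite setTI; apply: sub_sigma_algebra; left.
  by exists k, s.+1, B; split.
Qed.

Let history_measurable t : (0 < t <= T)%N -> <<s gen t>> `<=` @measurable _ Omega.
Proof.
move=> /andP[t0 tT]; apply: smallest_sub; first exact: sigma_algebra_measurable.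
move=> _ [[k [s [B [/andP[s0 st] mB ->]]]]|[k [s [i [/andP[s0 st] ->]]]]].
- have := @measurable_measurement k s _ measurableT _ mB.
  by rewrite setTI; apply; rewrite s0 (leq_trans (ltnW st)).
- by apply: ha; rewrite s0 (leq_trans st).
Qed.

Let rewards_events t (s : seq 'I_M) i (A : 'I_M -> set R) :
  (forall k, measurable (A k)) ->
  rewards_at r t (\bigcap_(k in [set` s]) (r i k t @^-1` A k)).
Proof.
move=> mA; apply: (@fin_bigcap_measurable _ (g_sigma_algebraType (rgen t))) => //.
by move=> k _; apply: sub_sigma_algebra; exists i, k, (A k).
Qed.

(** The agents [J] sampling the arm are frozen, so that their rewards are
    independent of each other and of [H]. *)
Let step i c n (J : {set 'I_M}) (H : Omega -> R) :
  (n < T)%N -> (forall w, 0 <= H w) ->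
  measurable_fun [set: g_sigma_algebraType (gen n.+1)] H ->
  (\int[Pr]_w (H w)%:E <= 1)%E ->
  (\int[Pr]_w (H w * \prod_(k <- enum J) expR (c k * (r i k n.+1 w - m i)
        - c k ^+ 2 * sg ^+ 2 / 2))%:E <= \int[Pr]_w (H w)%:E)%E.
Proof.
move=> nT H0 hH H1.
have tT : (0 < n.+1 <= T)%N by [].
have mH : measurable_fun [set: Omega] H.
  by move=> _ B mB; apply: (history_measurable tT); exact: hH.
pose g k y := expR (c k * (y - m i) - c k ^+ 2 * sg ^+ 2 / 2).
have mg k : measurable_fun setT (g k).
  apply: measurableT_comp => //; apply: measurable_funB => //.
  by apply: measurable_funM => //; exact: measurable_funB.
have int_g k : (\int[Pr]_w (g k (r i k n.+1 w))%:E <= 1)%E.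
  have [hsub _ _ _] := hr; have [_ /(_ (c k)) /le_expR_of_lne] := hsub i k n.+1 tT.
  rewrite /mmt_gen_fun unlock /= => hmgf.
  pose q := expR (- (m i * c k + sg ^+ 2 * c k ^+ 2 / 2)).
  have -> : (fun w => (g k (r i k n.+1 w))%:E) =
      (fun w => (q%:E * (expR (r i k n.+1 w * c k))%:E)%E).
    by apply/funext => w; rewrite -EFinM -expRD; congr (expR _)%:E; ring.
  rewrite ge0_integralZl//; last 2 first.
  - apply/measurable_EFinP; apply: measurableT_comp => //.
    by apply: measurable_funM => //; exact: measurable_funP.
  - by rewrite lee_fin expR_ge0.
  apply: (le_trans (lee_wpmul2l _ hmgf)); first by rewrite lee_fin expR_ge0.
  by rewrite -EFinM -expRD addNr expR0.
have int_g0 k : (0 <= \int[Pr]_w (g k (r i k n.+1 w))%:E)%E.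
  by apply: integral_ge0 => w _; rewrite lee_fin expR_ge0.
have fin_g k : (\int[Pr]_w (g k (r i k n.+1 w))%:E)%E \is a fin_num.
  by rewrite ge0_fin_numE// (le_lt_trans (int_g k)) ?ltry.
have int_H0 : (0 <= \int[Pr]_w (H w)%:E)%E.
  by apply: integral_ge0 => w _; rewrite lee_fin.
have fin_H : (\int[Pr]_w (H w)%:E)%E \is a fin_num.
  by rewrite ge0_fin_numE// (le_lt_trans H1) ?ltry.
have factor (A : 'I_M -> set R) : (forall k, measurable (A k)) ->
    (\int[Pr]_w (H w * \prod_(k <- enum J) \1_(A k) (r i k n.+1 w))%:E =
     (fine (\int[Pr]_w (H w)%:E))%:E *
     \big[mule/1]_(k <- enum J) Pr (r i k n.+1 @^-1` A k))%E.
  move=> mA; pose E := \bigcap_(k in [set` enum J]) (r i k n.+1 @^-1` A k).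
  have mE : measurable E.
    by apply: fin_bigcap_measurable => // k _; exact: measurable_funPTI.
  have PE : (Pr E = \big[mule/1]_(k <- enum J) Pr (r i k n.+1 @^-1` A k))%E.
    have [_ /(_ i) ind _ _] := hr.
    have := ind [seq (k, n.+1) | k <- enum J] (fun kt => A kt.1).
    rewrite big_map => <-.
    - congr (Pr _); apply/seteqP; split=> w Ew.
      + by move=> _ /mapP[k kJ ->] /=; exact: Ew.
      + by move=> k kJ; apply: (Ew (k, n.+1)); exact: map_f.
    - by rewrite map_inj_uniq ?enum_uniq// => ? ? [].
    - by move=> _ /mapP[k kJ ->].
    - by move=> kt; exact: mA.
  rewrite -PE fineK// muleC.
  have -> : (Pr E = (fine (Pr E))%:E)%E by rewrite fineK// fin_num_measure.
  have -> : (\int[Pr]_w (H w)%:E = \int[Pr]_w `|H w|%:E)%E.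
    by apply: eq_integral => w _; rewrite ger0_norm.
  rewrite -(@integral_factor _ _ _ Pr _ R (\1_E) H Num.norm)//.
  - apply: eq_integral => w _; rewrite ger0_norm// mulrC; congr (_ * _)%:E.
    by rewrite -prod_indic; apply: eq_bigr.
  - move=> B mB.
    have -> : (fun w => (\1_E w * \1_B (H w))%:E) = (fun w => (\1_(E `&` H @^-1` B) w)%:E : \bar R).
      by apply/funext => w; rewrite indicI.
    have hB : <<s gen n.+1>> (H @^-1` B) by have := hH measurableT _ mB; rewrite setTI.
    have mHB : measurable (H @^-1` B) by exact: history_measurable hB.
    rewrite integral_indic//; last exact: measurableI.
    rewrite setIT fineK ?fin_num_measure//.
    by have [_ _ _ /(_ _ tT)] := hr; apply => //; exact: rewards_events.
rewrite (@integral_factor_prod _ _ _ Pr _ (enum J) H (fun k w => r i k n.+1 w) g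
  (fine (\int[Pr]_w (H w)%:E))
  (fun k => fine (\int[Pr]_w (g k (r i k n.+1 w))%:E)))//.
- rewrite -[leRHS]fineK// lee_fin ler_piMr ?fine_ge0//.
  elim: (enum J) => [|k l ih]; first by rewrite big_nil.
  rewrite big_cons mulr_ile1 ?fine_ge0//.
  + by apply: prodr_ge0 => j _; rewrite fine_ge0.
  + by rewrite -lee_fin fineK.
- by move=> k y; exact: expR_ge0.
- exact: enum_uniq.
- by move=> k _; rewrite fineK.
Qed.

(** Which agents pull arm [i] in a round is known from the history, but the
    rewards they get are independent of it. Splitting on the set of these agents
    leaves, for each set, a product of independent exponentials of mean at most 1. *)
Lemma expectation_exp_compensated i c n : (n <= T)%N ->
  (\int[Pr]_w (expR (compensated_exponent i c n w))%:E <= 1)%E.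
Proof.
elim: n => [_|n IH nT].
  under eq_integral do rewrite /compensated_exponent big_ord0 expR0.
  by rewrite integral_cst//= mul1e probability_le1.
pose S := compensated_exponent i c n.
pose pattern w := [set k | a k n.+1 w == i]%SET.
pose g k w := expR (c n k * (r i k n.+1 w - m i) - c n k ^+ 2 * sg ^+ 2 / 2).
pose H (J : {set 'I_M}) w := (pattern w == J)%:R * expR (S w).
have HE w : \sum_J H J w = expR (S w).
  rewrite (bigD1 (pattern w))//= /H eqxx mul1r big1 ?addr0// => J.
  by rewrite eq_sym => /negbTE ->; rewrite mul0r.
have SE w : expR (compensated_exponent i c n.+1 w) =
    \sum_J H J w * \prod_(k <- enum J) g k w.
  rewrite (bigD1 (pattern w))//= [X in _ + X]big1 ?addr0 => [|J]; last first.
    by rewrite /H eq_sym => /negbTE ->; rewrite !mul0r.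
  rewrite /H eqxx mul1r /compensated_exponent big_ord_recr expRD; congr (_ * _).
  rewrite expR_sum [RHS]big_enum [RHS]big_mkcond; apply: eq_bigr => k _.
  rewrite inE; case: eqP => [->|_]; first by rewrite mul1r.
  by rewrite mul0r expR0.
have H0 J w : 0 <= H J w by rewrite mulr_ge0// expR_ge0.
have hH J : measurable_fun [set: g_sigma_algebraType (gen n.+1)] (H J).
  apply: (@measurable_funM _ (g_sigma_algebraType (gen n.+1))); last first.
    apply: measurableT_comp => //; exact: history_exponent.
  pose sel k := a k n.+1 @^-1` [set i].
  pose E k := if k \in J then sel k else ~` sel k.
  have -> : (fun w => (pattern w == J)%:R) = \1_(\bigcap_(k in setT) E k) :> (Omega -> R).
    apply/funext => w; rewrite indicE; congr (nat_of_bool _)%:R.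
    apply/eqP/idP => [PJ|].
      by rewrite inE => k _; rewrite /E -PJ inE; case: eqP.
    rewrite inE => HE'; apply/setP => k; have := HE' k I; rewrite /E !inE.
    by case: (k \in J) => /= [->|] //; [rewrite eqxx | move/eqP/negbTE].
  apply: (@measurable_indic _ (g_sigma_algebraType (gen n.+1))).
  apply: (@fin_bigcap_measurable _ (g_sigma_algebraType (gen n.+1))) => // k _.
  have mk : measurable (sel k : set (g_sigma_algebraType (gen n.+1))).
    by apply: sub_sigma_algebra; right; exists k, n.+1, i; rewrite ltn0Sn leqnn.
  by rewrite /E; case: ifP => _ //; exact: measurableC.
have mg k : measurable_fun setT (g k).
  apply: measurableT_comp => //; apply: measurable_funB => //.
  by apply: measurable_funM => //; exact: measurable_funB.
have tT : (0 < n.+1 <= T)%N by [].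
have mH J : measurable_fun [set: Omega] (H J).
  by move=> _ B mB; apply: (history_measurable tT); exact: hH.
have HS J w : H J w <= expR (S w).
  by rewrite /H; case: eqP => _; rewrite ?mul1r// mul0r expR_ge0.
have mS : measurable_fun setT (fun w => (expR (S w))%:E).
  apply/measurable_EFinP; apply: measurableT_comp => //.
  exact: measurable_compensated_exponent (ltnW nT).
have H1 J : (\int[Pr]_w (H J w)%:E <= 1)%E.
  apply: (le_trans _ (IH (ltnW nT))); apply: ge0_le_integral => //.
  - by move=> w _; rewrite lee_fin.
  - by apply/measurable_EFinP.
  - by move=> w _; rewrite lee_fin HS.
apply: (le_trans _ (IH (ltnW nT))).
under eq_integral do rewrite SE -sumEFin.
under [leRHS]eq_integral do rewrite -/(S _) -HE -sumEFin.
rewrite !ge0_integral_sum//.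
- by apply: lee_sum => J _; exact: step.
- by move=> J; apply/measurable_EFinP.
- by move=> J w _; rewrite lee_fin.
- move=> J; apply/measurable_EFinP; apply: measurable_funM => //.
  by apply: measurable_prod => k _.
- move=> J w _; rewrite lee_fin mulr_ge0//; apply: prodr_ge0 => k _.
  exact: expR_ge0.
Qed.

End ExponentialSupermartingale.

(** * Peeling and power sums *)

Lemma peeling_piece (R : realType) (x0 q x : R) (K : nat) : (0 < K)%N ->
  x0 <= x <= x0 * q ^+ K ->
  exists2 h : 'I_K, x0 * q ^+ h <= x & x <= x0 * q ^+ h.+1.
Proof.
elim: K => // K IH _ /andP[x0x xK].
have [xK'|xK'] := lerP x (x0 * q ^+ K); last by exists ord_max => //=; exact: ltW.
have [K0|K0] := posnP K.
  by exists ord_max; rewrite //= K0 expr0 mulr1.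
have [|h h1 h2] := IH K0; first by rewrite x0x.
by exists (widen_ord (leqnSn K) h).
Qed.

(** The scale [y] is random, but [th] has to be fixed beforehand. The chosen [th]
    gives the exponent [th * delta * y - th ^ 2 * sg ^ 2 / 2 * y ^ 2], concave in
    [y], equal values at [y1] and [y2]; relative to the best exponent
    [delta ^ 2 / (2 * sg ^ 2)] it loses the factor
    [4 y1 y2 / (y1 + y2) ^ 2 >= 1 - eta ^ 2 / 16]. *)
Lemma tilt_exponent_ge (R : realType) (delta sg G eta y1 y2 y Z V th : R) :
  th = 2 * delta / (sg ^+ 2 * (y1 + y2)) ->
  0 < sg -> 0 <= delta -> 0 < eta -> G = 1 - eta ^+ 2 / 16 ->
  0 < y1 -> y1 <= y <= y2 -> y2 ^+ 2 = (1 + eta) * y1 ^+ 2 ->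
  V <= y ^+ 2 -> delta * y <= Z ->
  G * (delta ^+ 2 / (2 * sg ^+ 2)) <= th * Z - th ^+ 2 * sg ^+ 2 / 2 * V.
Proof.
move=> thE sg0 d0 eta0 GE y10 /andP[yy1 yy2] y2E Vy Zy.
have y20 : 0 < y2 by lra.
have s0 : 0 < y1 + y2 by lra.
have th0 : 0 <= th by rewrite thE divr_ge0 ?mulr_ge0 ?exprn_ge0//; lra.
apply: (@le_trans _ _ (th * (delta * y) - th ^+ 2 * sg ^+ 2 / 2 * y ^+ 2)); last first.
  apply: lerB; first exact: ler_wpM2l.
  by rewrite ler_wpM2l// divr_ge0// mulr_ge0// exprn_ge0//; lra.
set c := delta ^+ 2 / sg ^+ 2.
have c0 : 0 <= c by rewrite divr_ge0 ?exprn_ge0//; lra.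
have -> : th * (delta * y) - th ^+ 2 * sg ^+ 2 / 2 * y ^+ 2 =
    2 * c * (y * (y1 + y2) - y ^+ 2) / (y1 + y2) ^+ 2.
  by rewrite thE /c; field; rewrite !lt0r_neq0.
have -> : G * (delta ^+ 2 / (2 * sg ^+ 2)) = c * (G / 2).
  by rewrite /c; field; rewrite lt0r_neq0.
have gap : 4 * (y2 - y1) <= eta * (y1 + y2).
  have e1 : eta * y1 ^+ 2 = (y2 - y1) * (y1 + y2) by nra.
  rewrite -(@ler_pM2r _ (y1 ^+ 2)) ?exprn_gt0//.
  have -> : eta * (y1 + y2) * y1 ^+ 2 = (y2 - y1) * (y1 + y2) ^+ 2 by nra.
  have h : 4 * y1 ^+ 2 <= (y1 + y2) ^+ 2 by nra.
  have : 0 <= (y2 - y1) * ((y1 + y2) ^+ 2 - 4 * y1 ^+ 2).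
    by rewrite mulr_ge0//; lra.
  by lra.
rewrite ler_pdivlMr ?exprn_gt0//.
have key : G * (y1 + y2) ^+ 2 <= 4 * (y1 * y2).
  have sq : (4 * (y2 - y1)) ^+ 2 <= (eta * (y1 + y2)) ^+ 2.
    by rewrite ler_sqr ?nnegrE//; nra.
  by rewrite GE; nra.
have between : 0 <= (y - y1) * (y2 - y) by rewrite mulr_ge0//; lra.
have half : G / 2 * (y1 + y2) ^+ 2 <= 2 * (y * (y1 + y2) - y ^+ 2) by lra.
by have := ler_wpM2l c0 half; lra.
Qed.

(** Peeling: [x] is random in a known range, which is cut into cells of ratio
    [1 + eta]; in its cell, the fixed tilt of that cell is good enough. *)
Lemma tail_exponent_ge (R : realType) (sg gamma G eta M x0 l x Z V : R) (K : nat) :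
  0 < sg -> 0 < gamma -> 0 < eta -> G = 1 - eta ^+ 2 / 16 -> 0 < G -> 0 < M ->
  0 < x0 -> 0 <= l -> (0 < K)%N -> x0 <= x <= x0 * (1 + eta) ^+ K ->
  M * V <= x -> sg * Num.sqrt (2 * gamma / G * (x / M) * l) <= Z ->
  let y h := Num.sqrt (x0 * (1 + eta) ^+ h / M) in
  let th h := 2 * (sg * Num.sqrt (2 * gamma / G * l)) /
              (sg ^+ 2 * (y h + y h.+1)) in
  exists h : 'I_K, gamma * l <= th h * Z - th h ^+ 2 * sg ^+ 2 / 2 * V.
Proof.
move=> sg0 g0 eta0 GE G0 M0 x00 l0 K0 xK Vx Zx y th.
have [h h1 h2] := peeling_piece K0 xK; exists h.
have q0 : 0 < 1 + eta by lra.
have yh j : y j ^+ 2 = x0 * (1 + eta) ^+ j / M.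
  by rewrite sqr_sqrtr// divr_ge0 ?mulr_ge0 ?exprn_ge0//; lra.
have xp : 0 < x by apply: lt_le_trans h1; rewrite mulr_gt0 ?exprn_gt0.
set delta := sg * Num.sqrt (2 * gamma / G * l).
have gG : 0 <= 2 * gamma / G by rewrite divr_ge0//; lra.
have dE : G * (delta ^+ 2 / (2 * sg ^+ 2)) = gamma * l.
  rewrite /delta exprMn sqr_sqrtr; last exact: mulr_ge0.
  by field; rewrite !lt0r_neq0.
rewrite -dE; apply: (@tilt_exponent_ge _ _ _ _ eta _ _ (Num.sqrt (x / M))) => //.
- by rewrite mulr_ge0 ?sqrtr_ge0//; lra.
- by rewrite sqrtr_gt0 divr_gt0 ?mulr_gt0 ?exprn_gt0.
- by rewrite !ler_wsqrtr// ler_pM2r ?invr_gt0.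
- by rewrite !yh exprS; field; exact: lt0r_neq0.
- by rewrite sqr_sqrtr ?divr_ge0//; [rewrite ler_pdivlMr// mulrC | lra | lra].
- apply: le_trans Zx; rewrite /delta -mulrA -sqrtrM; last exact: mulr_ge0.
  by rewrite [X in Num.sqrt X]mulrAC.
Qed.

Section PowerSums.
Variables (R : realType) (a : R).
Hypothesis a_gt0 : 0 < a.

Local Notation p n := (expR (- (a * ln n%:R))).
Local Notation t n := (expR (- ((1 + a) * ln n%:R))).

Let tE n : (0 < n)%N -> t n = p n / n%:R :> R.
Proof.
move=> n0; rewrite mulrDl mul1r opprD expRD [expR (- ln _)]expRN lnK ?posrE ?ltr0n//.
by rewrite mulrC.
Qed.

Let ln_step n : (0 < n)%N -> ln n.+1%:R - ln n%:R <= n%:R^-1 :> R.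
Proof.
move=> n0; have n0R : 0 < n%:R :> R by rewrite ltr0n.
rewrite -ln_div ?posrE ?ltr0n//.
have -> : n.+1%:R / n%:R = 1 + n%:R^-1 :> R.
  by rewrite -natr1 mulrDl divff ?lt0r_neq0// mul1r.
apply: le_ln1Dx; rewrite (lt_trans _ (_ : 0 < _))// ?invr_gt0//; lra.
Qed.

Let ln_step_ge n : (0 < n)%N -> n.+1%:R^-1 <= ln n.+1%:R - ln n%:R :> R.
Proof.
move=> n0; have n0R : 0 < n%:R :> R by rewrite ltr0n.
have n1R : 0 < n.+1%:R :> R by rewrite ltr0n.
rewrite -lerN2 opprB -ln_div ?posrE//.
have -> : n%:R / n.+1%:R = 1 + - n.+1%:R^-1 :> R.
  have -> : n%:R = n.+1%:R - 1 :> R by rewrite -natr1 addrK.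
  by rewrite mulrBl divff ?lt0r_neq0// mul1r.
by apply: le_ln1Dx; rewrite ltrN2 invf_lt1 ?ltr1n.
Qed.

Let t_le n : (0 < n)%N -> t n.+1 <= a^-1 * (p n - p n.+1).
Proof.
move=> n0; rewrite tE// ler_pdivlMl//.
have -> : p n = p n.+1 * expR (a * (ln n.+1%:R - ln n%:R)) :> R.
  by rewrite -expRD; congr expR; ring.
have h1 := expR_ge1Dx (a * (ln n.+1%:R - ln n%:R)).
have h2 : a * n.+1%:R^-1 <= a * (ln n.+1%:R - ln n%:R).
  by rewrite ler_pM2l// ln_step_ge.
have h3 : a / n.+1%:R <= expR (a * (ln n.+1%:R - ln n%:R)) - 1.
  by rewrite lerBrDl; apply: le_trans h1; rewrite lerD2l.
have := ler_wpM2l (expR_ge0 (- (a * ln n.+1%:R))) h3.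
by rewrite mulrBr mulr1 mulrA [_ * a]mulrC -mulrA.
Qed.

(** Discrete form of the integral of [x ^- (1 + a)], telescoping thanks to
    [p (n - 1) >= p n * (1 + a / n)] for [p n = n ^- a]. *)
Lemma sum_powers_le n : \sum_(2 <= j < n.+2) t j <= a^-1.
Proof.
apply: (@le_trans _ _ (a^-1 * (1 - p n.+1))); last first.
  by rewrite ler_piMr ?invr_ge0 ?(ltW a_gt0)// gerBl expR_ge0.
elim: n => [|n IH].
  by rewrite big_geq// ln1 mulr0 oppr0 expR0 subrr mulr0.
rewrite big_nat_recr//=; have := t_le (ltn0Sn n); lra.
Qed.

(** Abel summation against the telescoping bound of [sum_powers_le]: the
    increments of the logarithm are at most [1 / n]. *)
Lemma sum_log_powers_le n :
  \sum_(2 <= j < n.+2) t j * ln j%:R <= a^-1 ^+ 2 + a^-1.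
Proof.
have a1 : 0 < a^-1 by rewrite invr_gt0.
suff H : \sum_(2 <= j < n.+2) t j * ln j%:R <=
    a^-1 * (\sum_(1 <= j < n.+1) t j - ln n.+1%:R * p n.+1).
  apply: le_trans H _.
  have -> : a^-1 ^+ 2 + a^-1 = a^-1 * (a^-1 + 1) by rewrite expr2 mulrDr mulr1.
  rewrite ler_pM2l//.
  apply: (@le_trans _ _ (\sum_(1 <= j < n.+1) t j)).
    by rewrite gerBl mulr_ge0 ?expR_ge0// ln_ge0// ler1n.
  case: n => [|n]; first by rewrite big_geq// addr_ge0// ltW.
  by rewrite big_ltn// ln1 mulr0 oppr0 expR0 addrC lerD2r sum_powers_le.
elim: n => [|n IH].
  by rewrite !big_geq// ln1 mul0r subr0 mulr0.
rewrite big_nat_recr//= [in leRHS]big_nat_recr//=.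
have l0 : 0 <= ln n.+2%:R :> R by rewrite ln_ge0// ler1n.
have h1 := ler_wpM2r l0 (t_le (ltn0Sn n)).
have h2 : p n.+1 * (ln n.+2%:R - ln n.+1%:R) <= t n.+1.
  by rewrite (tE (ltn0Sn n)) ler_wpM2l ?expR_ge0// ln_step.
have := ler_wpM2l (ltW a1) h2.
nra.
Qed.

End PowerSums.

(** * Estimates along a trajectory *)

Lemma consensus_recursion (R : realType) (M : nat) (P : 'M[R]_M)
    (y v : nat -> 'cV[R]_M) n :
  y 0%N = 0 -> (forall s, y s.+1 = P *m (y s + v s.+1)) ->
  y n = \sum_(s < n) P ^+ (n - s) *m v s.+1.
Proof.
move=> y0 yS; elim: n => [|n IH]; first by rewrite big_ord0.
rewrite big_ord_recr /= subSnn expr1 yS mulmxDr; congr (_ + _).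
rewrite IH mulmx_sumr; apply: eq_bigr => s _.
by rewrite subSn ?(ltnW (ltn_ord s))// exprS -mulmxE mulmxA.
Qed.

(** Time read backwards: the estimates sum over injection times, the bounds on
    the weights over the ages of the injections. *)
Lemma reverse_ages (R : realType) (F : nat -> nat -> R) n :
  \sum_(s < n) F (n - s)%N s.+1 = \sum_(s < n) F s.+1 (n - s)%N.
Proof.
rewrite (reindex_inj rev_ord_inj) /=; apply: eq_bigr => s _.
by rewrite subKn// subnSK.
Qed.

Lemma round_robin_unique (N k i s s' : nat) : (s < N)%N -> (s' < N)%N ->
  ((s + k) %% N = (s' + k) %% N)%N -> s = s'.
Proof.
move=> sN s'N /eqP; rewrite eqn_modDr => /eqP.
by rewrite !modn_small.
Qed.

Section Grid.
Variables (R : realType) (eta : R).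
Hypothesis heta : 0 < eta < 4.

(** Enough cells of ratio [1 + eta] to cover an interval whose ends have ratio
    [2 n]. *)
Definition pieces (n : nat) : nat := (Num.truncn (ln (2 * n%:R) / ln (1 + eta) : R)).+1.

Lemma G_eta_gt0 : 0 < G_eta eta.
Proof. by case/andP: heta => e0 e4; rewrite /G_eta; nra. Qed.

Lemma ln1eta_gt0 : 0 < ln (1 + eta).
Proof. by case/andP: heta => e0 e4; rewrite ln_gt0//; lra. Qed.

Let log_ratio_ge0 n : (1 < n)%N -> 0 <= ln (2 * n%:R) / ln (1 + eta).
Proof.
move=> n1; rewrite divr_ge0 ?(ltW ln1eta_gt0)// ln_ge0//.
by rewrite -natrM ler1n; lia.
Qed.

Lemma pieces_cover n : (1 < n)%N -> 2 * n%:R <= (1 + eta) ^+ pieces n.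
Proof.
move=> n1; have n0 : 0 < 2 * n%:R :> R by rewrite mulr_gt0// ltr0n ltnW.
have q0 : 0 < 1 + eta by case/andP: heta; lra.
rewrite -ler_ln ?posrE ?exprn_gt0// lnXn// -[_ *+ pieces n]mulr_natl.
rewrite -ler_pdivrMr ?ln1eta_gt0// ltW//.
by case/andP: (truncn_itv (log_ratio_ge0 n1)).
Qed.

Lemma pieces_le n : (1 < n)%N ->
  (pieces n)%:R <= (ln (2 * n%:R) + ln (1 + eta)) / ln (1 + eta).
Proof.
move=> n1; have n0 : 0 < 2 * n%:R :> R by rewrite mulr_gt0// ltr0n ltnW.
rewrite mulrDl divff ?lt0r_neq0 ?ln1eta_gt0// /pieces -natr1 lerD2r.
by case/andP: (truncn_itv (log_ratio_ge0 n1)).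
Qed.

End Grid.

Section Trajectory.
Context (R : realType) (d : measure_display) (Omega : measurableType d).
Variables (Pr : probability Omega R) (M N T : nat).
Variables (P : 'M[R]_M) (lam : 'I_M -> R) (u : 'I_M -> 'cV[R]_M).
Variables (r : 'I_N -> 'I_M -> nat -> {RV Pr >-> R}).
Variables (a : 'I_M -> nat -> Omega -> 'I_N) (m : 'I_N -> R).
Variables (sg gamma eta : R) (f : R -> R).
Hypotheses (P_ge0 : forall x y, 0 <= P x y) (P_sum : forall x, \sum_y P x y = 1).
Hypotheses (P_sym : forall x y, P x y = P y x).
Hypothesis P_conn : forall x y, connect [rel x y | 0 < P x y] x y.
Hypothesis spec : consensus_spectrum P lam u.
Hypotheses (hMN : (M <= N)%N) (hN : (1 < N)%N).
Hypothesis halg : coop_UCB2_selective_learning T P sg gamma eta f r a.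

Variable w : Omega.
Local Notation sel := (fun k t => a k t w).
Local Notation rew := (fun i k t => r i k t w).
Local Notation nh i n k := (nhat P sel i n k 0).
Local Notation sh i n k := (shat P rew sel i n k 0).
Local Notation x i k t := (xi R sel i k t).

Let x01 i k t : 0 <= x i k t <= 1.
Proof. by rewrite /xi ler0n lern1 leq_b1. Qed.

Let nhatE i n k : nh i n k = \sum_(s < n) \sum_j (P ^+ s.+1) k j * x i j (n - s)%N.
Proof.
have -> : nhat P sel i n = \sum_(s < n) P ^+ (n - s) *m (\col_j x i j s.+1).
  exact: (consensus_recursion (v := fun s => \col_j x i j s)).
rewrite summxE -(reverse_ages (fun p t => \sum_j (P ^+ p) k j * x i j t)).
by apply: eq_bigr => s _; rewrite mxE; apply: eq_bigr => j _; rewrite mxE.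
Qed.

Let centered_shatE i n k : sh i n k - m i * nh i n k =
  \sum_(s < n) \sum_j x i j s.+1 * ((P ^+ (n - s)) k j * (r (sel j s.+1) j s.+1 w - m i)).
Proof.
have -> : shat P rew sel i n =
    \sum_(s < n) P ^+ (n - s) *m (\col_j (r i j s.+1 w * x i j s.+1)).
  exact: (consensus_recursion (v := fun s => \col_j (rew i j s * x i j s))).
rewrite nhatE -(reverse_ages (fun p t => \sum_j (P ^+ p) k j * x i j t)).
rewrite summxE mulr_sumr -sumrB; apply: eq_bigr => s _.
rewrite mxE mulr_sumr -sumrB; apply: eq_bigr => j _; rewrite mxE /xi.
by case: eqP => [->|_] /=; ring.
Qed.

Lemma nhat_ge0 i n k : 0 <= nh i n k.
Proof.
rewrite nhatE sumr_ge0// => s _; rewrite sumr_ge0// => j _.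
by rewrite mulr_ge0 ?expmx_ge0//; case/andP: (x01 i j (n - s)).
Qed.

Lemma nhat_le i n k : nh i n k <= n%:R.
Proof.
rewrite nhatE -[leRHS](_ : \sum_(s < n) 1 = _); last by rewrite sumr_const card_ord.
apply: ler_sum => s _; rewrite -(expmx_sum P_sum s.+1 k); apply: ler_sum => j _.
by rewrite ler_piMr ?expmx_ge0//; case/andP: (x01 i j (n - s)).
Qed.

Lemma nhat_ge_average i n k :
  M%:R^-1 * (\sum_(s < n) \sum_j x i j s.+1) - eps_n lam <= nh i n k.
Proof.
have := consensus_sum_deviation spec n k (x := fun s j => x i j (n - s)%N).
move=> /(_ (fun s j => x01 i j (n - s)%N)); rewrite -nhatE.
rewrite -(reverse_ages (fun _ t => \sum_j x i j t)) ler_norml => /andP[+ _].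
by set avg := _ * _; lra.
Qed.

Lemma nhat_variance i n k :
  M%:R * \sum_(s < n) \sum_j (P ^+ (n - s)) k j ^+ 2 * x i j s.+1
  <= nh i n k + eps_c lam u k.
Proof.
rewrite (reverse_ages (fun p t => \sum_j (P ^+ p) k j ^+ 2 * x i j t)) nhatE.
apply: (consensus_square_sum_le spec n k (x := fun s j => x i j (n - s)%N)).
by move=> s j; exact: x01.
Qed.

Let round_robin (k : 'I_M) s : (s < N)%N -> (s < T)%N ->
  a k s.+1 w = ((s + k) %% N)%N :> nat.
Proof.
move=> sN sT; have := halg k w (t := s.+1) sT.
by rewrite /coop_UCB2_selective_learning_at sN.
Qed.

Let slot (i : 'I_N) (k : 'I_M) : nat := ((i + N - k) %% N)%N.

Let slot_lt i k : (slot i k < N)%N.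
Proof. by rewrite ltn_mod (leq_ltn_trans _ hN). Qed.

Let slotE i (k : 'I_M) : ((slot i k + k) %% N = i)%N.
Proof.
rewrite /slot modnDml subnK; first by rewrite modnDr modn_small.
by rewrite (leq_trans (ltnW (ltn_ord k)))// (leq_trans hMN)// leq_addl.
Qed.

Let slot_sampled i k : (N <= T)%N -> a k (slot i k).+1 w = i.
Proof.
move=> NT; apply: val_inj; rewrite /= round_robin ?slotE//.
exact: leq_trans (slot_lt i k) NT.
Qed.

Let age_bound i n k : (N <= n)%N -> ((n - (slot i k).+1) < n)%N.
Proof. by move=> Nn; have := slot_lt i k; lia. Qed.

Let sampled_at_age i n k : (N <= n <= T)%N ->
  x i k (n - (n - (slot i k).+1))%N = 1.
Proof.
move=> /andP[Nn nT]; rewrite subKn; last exact: leq_trans (slot_lt i k) Nn.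
by rewrite /xi slot_sampled ?eqxx//; exact: leq_trans nT.
Qed.

(** Round-robin sampling makes the agents pull a given arm at distinct times, so
    that [staggered_weight_ge] applies. *)
Lemma nhat_eps_c_ge i n k : (N <= n <= T)%N -> 3 / 4 <= nh i n k + eps_c lam u k.
Proof.
move=> NnT; have /andP[Nn nT] := NnT; rewrite nhatE.
apply: (staggered_weight_ge P_ge0 P_sum spec k (x := fun s j => x i j (n - s)%N)
  (age := fun j => (n - (slot i j).+1)%N)).
- by move=> s j; exact: x01.
- move=> j j' /eqP; rewrite eqn_sub2lE; try exact: leq_trans (slot_lt i _) Nn.
  move=> /eqP[sl]; apply: val_inj => /=.
  have /eqP : ((slot i j + j) %% N = (slot i j + j') %% N)%N.
    by rewrite slotE sl slotE.
  rewrite eqn_modDl !modn_small => [/eqP//||]; exact: leq_trans (ltn_ord _) hMN.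
- by move=> j; exact: age_bound.
- by move=> j; exact: sampled_at_age.
Qed.

(** Without this, a vanishing count would make the bonus zero and say nothing
    about the estimate. The round-robin pull of [i] by [k] is at least
    [2 (M - 1)] rounds old, an age at which all weights are positive. *)
Lemma nhat_gt0 i n k : (N + M.-1.*2 <= n <= T)%N -> 0 < nh i n k.
Proof.
move=> /andP[Nn nT]; have NN : (N <= n)%N by lia.
rewrite nhatE (bigD1 (Ordinal (age_bound i k NN)))//= ltr_pwDl//; last first.
  apply: sumr_ge0 => s _; apply: sumr_ge0 => j _.
  by rewrite mulr_ge0 ?expmx_ge0//; case/andP: (x01 i j (n - s)).
rewrite (bigD1 k)//= sampled_at_age ?NN// mulr1 ltr_pwDl//.
  apply: (expmx_gt0 P_ge0 P_sum P_sym P_conn spec).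
  by have := slot_lt i k; lia.
apply: sumr_ge0 => j _.
by rewrite mulr_ge0 ?expmx_ge0//; case/andP: (x01 i j (n - (n - (slot i k).+1))).
Qed.

Lemma round_robin_count i n : (n <= N)%N -> (n <= T)%N ->
  \sum_(s < n) \sum_j x i j s.+1 <= M%:R.
Proof.
move=> nN nT; rewrite exchange_big /=.
rewrite -[leRHS](_ : \sum_(j < M) 1 = _); last by rewrite sumr_const card_ord.
apply: ler_sum => j _.
have [[s xs]|none] := pselect (exists s : 'I_n, a j s.+1 w = i).
  rewrite (bigD1 s)//= [X in _ + X]big1 ?addr0; first by case/andP: (x01 i j s.+1).
  move=> s' ss'; rewrite /xi /=; case: eqP => // xs'; case/eqP: ss'; apply: val_inj.
  apply: (@round_robin_unique N j i); try exact: leq_trans (ltn_ord _) nN.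
  have lt1 (q : 'I_n) := leq_trans (ltn_ord q) nN.
  have lt2 (q : 'I_n) := leq_trans (ltn_ord q) nT.
  by rewrite -(round_robin j (lt1 s') (lt2 s')) -(round_robin j (lt1 s) (lt2 s)) xs xs'.
rewrite big1// => s _; rewrite /xi; case: eqP => // xs.
by case: none; exists s.
Qed.

Hypotheses (hsg : 0 < sg) (hgamma : 1 < gamma) (heta : 0 < eta < 4).

(** The tilt that [tilt_exponent_ge] asks for on cell [h], with
    [max (f n) (3 / 4)] as the lower end of the range of [nhat + f n]. *)
Definition tilt (n h : nat) : R :=
  let y j := Num.sqrt (Num.max (f n%:R) (3 / 4) * (1 + eta) ^+ j / M%:R) in
  2 * (sg * Num.sqrt (2 * gamma / G_eta eta * ln n%:R)) /
  (sg ^+ 2 * (y h + y h.+1)).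

(** On the event that the estimate of arm [i] exceeds its bonus on the side given
    by [neg], one of these exponentials is at least 1; each has expectation at most
    [n ^- gamma]. So their sum dominates the indicator of the event. *)
Definition deviation (neg : bool) (k : 'I_M) (i : 'I_N) (n : nat) (w : Omega) : R :=
  \sum_(h < pieces eta n)
    expR (compensated_exponent r a m sg i
            (fun s j => (-1) ^+ neg * tilt n h * (P ^+ (n - s)) k j) n w
          - gamma * ln n%:R).

Lemma deviation_ge0 (neg : bool) k i n w' : 0 <= deviation neg k i n w'.
Proof. by apply: sumr_ge0 => h _; exact: expR_ge0. Qed.

Local Notation C i k n := (C_bonus P sel sg gamma eta f i k n).
Local Notation mu i k n := (muhat P rew sel i k n).

Lemma deviation_ge1 (neg : bool) k i n : (N <= n <= T)%N -> 0 < nh i n k ->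
  eps_c lam u k <= f n%:R ->
  C i k n < (-1) ^+ neg * (mu i k n - m i) -> 1 <= deviation neg k i n w.
Proof.
move=> NnT nh0 ef Cmu.
have n1 : (1 < n)%N by apply: leq_trans hN _; case/andP: NnT.
have /andP[e0 e4] := heta.
have M0 : 0 < M%:R :> R by rewrite ltr0n (leq_trans _ (ltn_ord k)).
have n0 : 0 < n%:R :> R by rewrite ltr0n ltnW.
have c0 := eps_c_ge0 spec k.
have nf : 3 / 4 <= nh i n k + f n%:R.
  by apply: le_trans (nhat_eps_c_ge i k NnT) _; rewrite lerD2l.
pose Z : R := (-1) ^+ neg * (sh i n k - m i * nh i n k).
pose V : R := \sum_(s < n) \sum_j (P ^+ (n - s)) k j ^+ 2 * x i j s.+1.
pose x0 := Num.max (f n%:R) (3 / 4).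
have x00 : 0 < x0 by rewrite lt_max; apply/orP; right; lra.
have ln0 : 0 <= ln n%:R :> R by rewrite ln_ge0// ler1n ltnW.
have [] := @tail_exponent_ge _ sg gamma (G_eta eta) eta M%:R x0 (ln n%:R)
  (nh i n k + f n%:R) Z V (pieces eta n) hsg (lt_trans ltr01 hgamma) e0 erefl
  (G_eta_gt0 heta) M0 x00 ln0 isT.
- apply/andP; split.
    by rewrite ge_max nf andbT lerDr nhat_ge0.
  apply: le_trans (ler_wpM2l (ltW x00) (pieces_cover heta n1)).
  have h1 : f n%:R <= x0 by rewrite le_max lexx.
  have h2 : 3 / 4 <= x0 by rewrite le_max lexx orbT.
  have h3 := nhat_le i n k.
  have h4 : 2 <= n%:R :> R by rewrite ler_nat.
  nra.
- by apply: le_trans (nhat_variance i n k) _; rewrite lerD2l.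
- have -> : Z = nh i n k * ((-1) ^+ neg * (mu i k n - m i)).
    by rewrite /Z /muhat; field; exact: lt0r_neq0.
  apply: le_trans (ler_wpM2l (ltW nh0) (ltW Cmu)).
  rewrite /C_bonus [leRHS]mulrCA ler_pM2l// -[X in _ <= X * _](gtr0_norm nh0) -sqrtr_sqr -sqrtrM ?sqr_ge0//.
  by rewrite ler_wsqrtr// le_eqVlt; apply/orP; left; apply/eqP; field; rewrite !lt0r_neq0// (G_eta_gt0 heta).
move=> h H; rewrite /deviation (bigD1 h)//= -[leLHS]addr0 lerD//; last first.
  by apply: sumr_ge0 => j _; exact: expR_ge0.
rewrite -[leLHS]expR0 ler_expR subr_ge0.
have {}H : gamma * ln n%:R <= tilt n h * Z - tilt n h ^+ 2 * sg ^+ 2 / 2 * V := H.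
apply: (le_trans H).
rewrite le_eqVlt; apply/orP; left; apply/eqP.
have -> : Z = (-1) ^+ neg * \sum_(s < n) \sum_j x i j s.+1 *
    ((P ^+ (n - s)) k j * (r (sel j s.+1) j s.+1 w - m i)).
  by rewrite /Z centered_shatE.
rewrite /V mulrA !mulr_sumr -sumrB; apply: eq_bigr => s _.
rewrite !mulr_sumr -sumrB; apply: eq_bigr => j _.
by rewrite /xi !exprMn sqrr_sign mul1r; ring.
Qed.

End Trajectory.

(** * Choosing an arm *)

Lemma card_ord_lt (n k : nat) : (k <= n)%N -> #|[set l : 'I_n | (l < k)%N]%SET| = k.
Proof.
move=> kn; have winj : injective (widen_ord kn) by move=> ? ? [] /val_inj.
rewrite -[RHS]card_ord -(card_imset _ winj).
apply: eq_card => l; rewrite !inE; apply/idP/imsetP => [lk|[l' _ ->] /=].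
  by exists (Ordinal lk) => //; apply: val_inj.
exact: ltn_ord.
Qed.

Section Arms.
Variables (R : realType) (N : nat) (m : 'I_N -> R) (b : {perm 'I_N}).
Hypothesis hb : ranking m b.

Lemma ranking_le x y : (m (b x) <= m (b y)) = (y <= x)%N.
Proof.
case: (ltngtP y x) => [yx|xy|/val_inj->]; last by rewrite lexx.
- exact/ltW/hb.
- by apply/negbTE; rewrite -ltNge; exact: hb.
Qed.

Lemma ranking_inj : injective m.
Proof.
move=> i j ij; rewrite -(permKV b i) -(permKV b j); congr (b _).
apply: val_inj; apply/eqP; rewrite eqn_leq.
by rewrite -!ranking_le !permKV ij lexx.
Qed.

Lemma Delta_min_le i j : i != j -> Delta_min m <= `|m i - m j|.
Proof.
move=> ij; apply: ge_inf; last by exists (i, j).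
by exists 0 => _ [ij' _ <-].
Qed.

Lemma Delta_min_gt0 : (1 < N)%N -> 0 < Delta_min m.
Proof.
move=> N1; pose ij0 := (Ordinal (ltnW N1), Ordinal N1).
have ne0 : ij0.1 != ij0.2 by [].
pose F (ij : 'I_N * 'I_N) := `|m ij.1 - m ij.2|.
have [ij ne le_ij] := @arg_minP _ _ _ ij0 (fun ij => ij.1 != ij.2) F ne0.
apply: (@lt_le_trans _ _ (F ij)).
  rewrite normr_gt0 subr_eq0; apply: contra ne => /eqP e.
  by apply/eqP; exact: ranking_inj.
apply: lb_le_inf; first by exists (F ij0), ij0.
by move=> _ [ij' ne' <-]; exact: le_ij.
Qed.

(** Suppose the conclusion fails. If [i] is worse than the target, it stands in
    [O] for some arm among the [k + 1] best, whose upper index then lies below that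
    of [i]. If [i] is better, [O] has to contain an arm no better than the target,
    whose lower index [i] does not exceed. Either way the means differ by at most
    twice the bonus of [i]. *)
Lemma selective_choice_deviates (mu C : 'I_N -> R) (k : 'I_N) (O : {set 'I_N})
    (i : 'I_N) :
  #|O| = k.+1 -> (forall i j, i \in O -> j \notin O -> mu j + C j <= mu i + C i) ->
  i \in O -> (forall j, j \in O -> mu i - C i <= mu j - C j) ->
  i != b k -> 2 * C i < Delta_min m ->
  (exists j, C j < (-1) ^+ (m i < m (b k))%R * (mu j - m j)) \/
  C i < (-1) ^+ (~~ (m i < m (b k))%R) * (mu i - m i).
Proof.
move=> cO Otop iO Omin ik gap.
have gapk : Delta_min m <= `|m i - m (b k)| by exact: Delta_min_le.
have [worse|] := boolP (m i < m (b k)) => /=.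
- rewrite expr1 expr0 mul1r; apply: contrapT => /not_orP[nj /negP ni].
  rewrite -leNgt in ni.
  have good j : m j <= mu j + C j.
    rewrite leNgt; apply/negP => lt; apply: nj; exists j; rewrite mulN1r; lra.
  pose best := [set b l | l : 'I_N in [set l : 'I_N | (l <= k)%N]%SET]%SET.
  have cbest : #|best| = k.+1.
    rewrite card_imset; last exact: perm_inj.
    exact: card_ord_lt (ltn_ord k).
  have [l lk lO] : exists2 l : 'I_N, (l <= k)%N & b l \notin O.
    apply: contrapT => H.
    have sub : best \subset O.
      apply/fintype.subsetP => _ /imsetP[l /[!inE] lk ->].
      by apply: contrapT => /negP lO; apply: H; exists l.
    have /eqP E : best == O by rewrite eqEcard sub cO cbest leqnn.
    move: iO; rewrite -E => /imsetP[l /[!inE] lk il].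
    by move: worse; rewrite il ltNge ranking_le lk.
  have h1 := Otop _ _ iO lO; have h2 := good (b l).
  have h3 : m (b k) <= m (b l) by rewrite ranking_le.
  by move: gapk; rewrite distrC ger0_norm; lra.
- rewrite -leNgt => better; rewrite expr1 expr0.
  have {}better : m (b k) < m i.
    rewrite lt_neqAle better andbT; apply: contra ik => /eqP e.
    by apply/eqP; apply: ranking_inj.
  apply: contrapT => /not_orP[nj /negP ni]; rewrite mulN1r -leNgt in ni.
  have good j : mu j - C j <= m j.
    rewrite leNgt; apply/negP => lt; apply: nj; exists j; rewrite mul1r; lra.
  have [j jO jk] : exists2 j, j \in O & m j <= m (b k).
    apply: contrapT => H.
    have sub : O \subset [set b l | l : 'I_N in [set l : 'I_N | (l < k)%N]%SET]%SET.
      apply/fintype.subsetP => j jO; apply/imsetP; exists ((b^-1)%g j).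
        rewrite inE ltnNge -ranking_le permKV; apply/negP => jk.
        by apply: H; exists j.
      by rewrite permKV.
    have := subset_leq_card sub; rewrite cO card_imset; last exact: perm_inj.
    by rewrite card_ord_lt ?ltnn// ltnW.
  have h1 := Omin j jO; have h2 := good j.
  by move: gapk; rewrite ger0_norm; lra.
Qed.

End Arms.

(** [c * (nh + fT) <= nh ^ 2] is what the threshold, the larger root of
    [X ^ 2 = c * (X + fT)] with [c] as in the proof, amounts to. *)
Lemma threshold_gap (R : realType) (sg gamma G M D lT ln fT fn nh : R) :
  0 < sg -> 0 < gamma -> 0 < G -> 0 < M -> 0 < D -> 0 <= ln < lT ->
  0 <= fn <= fT ->
  4 * sg ^+ 2 * gamma / (D ^+ 2 * G) *
    (1 + Num.sqrt (1 + D ^+ 2 * M * G / (2 * sg ^+ 2 * gamma) * (fT / lT))) * lT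
  <= M * nh ->
  2 * (sg * Num.sqrt (2 * gamma / G * ((nh + fn) / (M * nh)) * (ln / nh))) < D.
Proof.
move=> s0 g0 G0 M0 D0 /andP[ln0 lnlT] /andP[fn0 fnT].
have lT0 : 0 < lT by lra.
set S := Num.sqrt _.
pose c := 8 * sg ^+ 2 * gamma * lT / (G * M * D ^+ 2).
have c0 : 0 < c by rewrite divr_gt0 ?mulr_gt0 ?exprn_gt0.
have SE : S ^+ 2 = 1 + 4 * fT / c.
  rewrite sqr_sqrtr; last first.
    apply: addr_ge0 => //; apply: mulr_ge0; apply: divr_ge0; try lra.
      by rewrite !mulr_ge0 ?exprn_ge0 ?ltW.
    by rewrite !mulr_ge0 ?exprn_ge0 ?ltW.
  by rewrite /c; field; rewrite !lt0r_neq0 ?exprn_gt0.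
have S0 : 0 <= S by exact: sqrtr_ge0.
have -> : 4 * sg ^+ 2 * gamma / (D ^+ 2 * G) * (1 + S) * lT = M * (c / 2 * (1 + S)).
  by rewrite /c; field; rewrite !lt0r_neq0.
rewrite ler_pM2l// => nhS.
have nh0 : 0 < nh by apply: lt_le_trans nhS; rewrite mulr_gt0//; lra.
have sq : c * (nh + fT) <= nh ^+ 2.
  have h : (c / 2 * S) ^+ 2 <= (nh - c / 2) ^+ 2.
    by rewrite ler_sqr ?nnegrE; [lra | rewrite mulr_ge0//; lra | nra].
  have e : (c / 2 * S) ^+ 2 = c ^+ 2 / 4 + c * fT.
    by rewrite exprMn SE; field; exact: lt0r_neq0.
  by rewrite e in h; lra.
rewrite mulrA -ltr_pdivlMl ?mulr_gt0// -[ltRHS]ger0_norm; last first.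
  by rewrite mulr_ge0 ?invr_ge0 ?mulr_ge0 ?ltW.
rewrite -sqrtr_sqr ltr_sqrt; last first.
  by rewrite exprn_gt0// mulr_gt0 ?invr_gt0 ?mulr_gt0.
have -> : 2 * gamma / G * ((nh + fn) / (M * nh)) * (ln / nh) =
    ((2 * sg)^-1 * D) ^+ 2 * (c * (nh + fn) * ln / (nh ^+ 2 * lT)).
  by rewrite /c; field; rewrite !lt0r_neq0.
rewrite gtr_pMr; last by rewrite exprn_gt0// mulr_gt0 ?invr_gt0 ?mulr_gt0.
rewrite ltr_pdivrMr ?mulr_gt0 ?exprn_gt0// mul1r.
have h1 : c * (nh + fn) <= nh ^+ 2 by apply: le_trans sq; rewrite ler_pM2l//; lra.
apply: (@le_lt_trans _ _ (nh ^+ 2 * ln)); first by rewrite ler_wpM2r.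
by rewrite ltr_pM2l// exprn_gt0.
Qed.

Lemma f_inv_spec (R : realType) (t0 : R) (f : R -> R) (y : R) :
  increasing_sublogarithmic t0 f -> (f @` [set x | t0 <= x]) y ->
  t0 <= f_inv t0 f y /\ (forall x, f_inv t0 f y <= x -> y <= f x).
Proof.
move=> [inc _] [x0 /= x0t fx0].
have mono x x' : t0 <= x -> x < x' -> f x < f x'.
  move=> tx xx'; apply: inc => //; rewrite in_itv /= andbT//.
  exact: le_trans (ltW xx').
have inj : {in [set x | t0 <= x] &, injective f}.
  move=> x x'; rewrite !inE /= => tx tx' fxx'.
  case: (ltgtP x x') => // h; first by have := mono _ _ tx h; rewrite fxx' ltxx.
  by have := mono _ _ tx' h; rewrite fxx' ltxx.
have -> : f_inv t0 f y = x0 by rewrite /f_inv -fx0 pinvKV ?inE.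
split=> // x; rewrite le_eqVlt => /predU1P[<-|/(mono _ _ x0t)/ltW]; rewrite -fx0//.
Qed.

(** The union bound costs about half of the last term on the right. In particular
    the summand [A], at least [L], leaves [2 * M * (N + 1)] rounds, enough for the
    [2 * M + 1] early rounds of each agent; what is lost in the number of cells is
    absorbed by [v ^ 2 + 1 >= 2 * v] for [v = 1 / (g - 1)]. *)
Lemma excess_budget (R : realType) (M N : nat) (g L A S : R) : (M <= N)%N ->
  1 < g -> 0 < L -> L <= A ->
  S <= ((ln 2 + L) / (g - 1) + (g - 1)^-1 ^+ 2 + (g - 1)^-1) / L ->
  M%:R * (2 * M%:R + 1) + M%:R * (N%:R + 1) * S <=
  1 + 2 * M%:R * (N%:R + 1) / L * (1 / (g - 1) ^+ 2 + g * A / (g - 1) + 1).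
Proof.
move=> MN g1 L0 LA; set v := (g - 1)^-1 => HS.
have v0 : 0 < v by rewrite invr_gt0; lra.
have gv : g * v = 1 + v.
  rewrite -{1}(subrK 1 g) mulrDl mul1r divff//; lra.
have MN' : M%:R <= N%:R :> R by rewrite ler_nat.
have M0 : 0 <= M%:R :> R by rewrite ler0n.
have ln2 : ln 2 <= 1 :> R.
  have := @le_ln1Dx R 1; rewrite -(@natrD R 1 1) => -> //; lra.
have W0 : 0 <= M%:R * (N%:R + 1) :> R by rewrite mulr_ge0//; lra.
have -> : 1 / (g - 1) ^+ 2 = v ^+ 2 by rewrite /v exprVn mul1r.
have -> : g * A / (g - 1) = (1 + v) * A by rewrite -mulrA [A / _]mulrC mulrA gv.
pose l := L^-1; have l0 : 0 < l by rewrite invr_gt0.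
have lL : l * L = 1 by rewrite mulVf// lt0r_neq0.
have lA : 1 <= l * A by rewrite -lL ler_pM2l.
have {}HS : S <= v + l * (2 * v + v ^+ 2).
  apply: (le_trans HS); rewrite -/l.
  have : l * (ln 2 * v) <= l * (1 * v) by rewrite ler_pM2l// ler_pM2r.
  have -> : (ln 2 + L) / (g - 1) = ln 2 * v + L * v by rewrite mulrDl.
  have : l * L * v = v by rewrite lL mul1r.
  lra.
have q : 0 <= l * ((v - 1) ^+ 2 + 1) 
  by apply: mulr_ge0; [exact: ltW | rewrite addr_ge0 ?sqr_ge0].
have H : S + 2 <= 2 * l * (v ^+ 2 + (1 + v) * A + 1).
  have : 1 + v <= (1 + v) * (l * A) by rewrite ler_peMr//; lra.
  lra.
have := ler_wpM2l W0 H.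
have -> : 2 * M%:R * (N%:R + 1) / L = M%:R * (N%:R + 1) * (2 * l) by rewrite /l; lra.
have : M%:R * (2 * M%:R + 1) <= M%:R * (N%:R + 1) * 2 :> R by nra.
lra.
Qed.

(** * Counting the pulls of wrong arms *)

Lemma sum_window_le (R : realType) (N q T : nat) :
  \sum_(n < T) ((N <= n < N + q)%N)%:R <= q%:R :> R.
Proof.
rewrite -natr_sum ler_nat.
suff : (\sum_(n < T) (N <= n < N + q) <= minn q (T - N))%N.
  by move=> h; apply: leq_trans h _; rewrite geq_minl.
elim: T => [|T IH]; first by rewrite big_ord0.
rewrite big_ord_recr /=; move: IH; set S := (\sum_(_ < _) _)%N.
by case: (leqP N T); case: (ltnP T (N + q)) => /=; lia.
Qed.

Lemma sum_before_le (R : realType) (N T : nat) (tau : R) : (0 < N)%N -> 0 <= tau ->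
  \sum_(n < T) ((N <= n)%N && (n%:R < tau))%:R <= tau.
Proof.
move=> N0 tau0.
pose S n : R := \sum_(j < n) ((N <= j)%N && (j%:R < tau))%:R.
suff [] : S T <= T.-1%:R /\ S T <= tau by [].
rewrite /S; elim: T => [|n [IH1 IH2]]; first by rewrite big_ord0.
rewrite big_ord_recr /=; case: (leqP N n) => [Nn|_] /=; last first.
  rewrite addr0; split=> //; apply: le_trans IH1 _.
  by rewrite ler_nat leq_pred.
have nE : n%:R = n.-1%:R + 1 :> R by rewrite natr1 prednK// (leq_trans N0).
have [h|h] := ltP n%:R tau; last by rewrite addr0; split=> //; rewrite nE; lra.
by rewrite mulr1n; split; lra.
Qed.

Section PullCounts.
Context (R : realType) (d : measure_display) (Omega : measurableType d).
Variables (Pr : probability Omega R) (M N T : nat).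
Hypotheses (hM : (0 < M)%N) (hMN : (M <= N)%N) (hN : (1 < N)%N) (hT : (0 < T)%N).
Variables (P : 'M[R]_M) (lam : 'I_M -> R) (u : 'I_M -> 'cV[R]_M).
Hypotheses (P_ge0 : forall x y, 0 <= P x y) (P_sum : forall x, \sum_y P x y = 1).
Hypotheses (P_sym : forall x y, P x y = P y x).
Hypothesis P_conn : forall x y, connect [rel x y | 0 < P x y] x y.
Hypothesis spec : consensus_spectrum P lam u.
Variables (m : 'I_N -> R) (b : {perm 'I_N}).
Hypothesis hb : ranking m b.
Variables (sg gamma eta : R).
Hypotheses (hsg : 0 < sg) (hgamma : 1 < gamma) (heta : 0 < eta < 4).
Variables (t0 : R) (f : R -> R).
Hypotheses (ht0 : 0 <= t0 <= 1) (hf : increasing_sublogarithmic t0 f).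
Hypothesis hrange : forall k, (f @` [set x | t0 <= x]) (eps_c lam u k).
Variables (r : 'I_N -> 'I_M -> nat -> {RV Pr >-> R}).
Variables (a : 'I_M -> nat -> Omega -> 'I_N).
Hypotheses (ha : random_selections T a) (hr : reward_model T r a m sg).
Hypothesis halg : coop_UCB2_selective_learning T P sg gamma eta f r a.

Local Notation tdag k := (t_dagger lam u t0 f k).
Local Notation tgt k := (target hMN b k).
Local Notation x i k t w := (xi R (fun k' t' => a k' t' w) i k t).
Local Notation dev := (deviation P r a m sg gamma eta f).

Let D := Delta_min m.
Let G := G_eta eta.

Definition leading_term : R :=
  4 * sg ^+ 2 * gamma / (D ^+ 2 * G) *
    (1 + Num.sqrt (1 + D ^+ 2 * M%:R * G / (2 * sg ^+ 2 * gamma) *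
                       (f T%:R / ln T%:R))) * ln T%:R.

(** Number of pulls of an arm by the group beyond which, whatever the agent, the
    bonus of this arm is below half the smallest gap: consensus may hide
    [M * eps_n] of them. *)
Definition enough : R := leading_term + M%:R * eps_n lam.

Definition pulls (i : 'I_N) (n : nat) (w : Omega) : R :=
  \sum_(s < n) \sum_j x i j s.+1 w.

(** The side on which estimates have to fail depends on whether arm [i] is worse
    or better than the target of [k]. *)
Definition misled (k : 'I_M) (i : 'I_N) (n : nat) (w : Omega) : R :=
  \sum_j dev (m i < m (tgt k))%R k j n w + dev (~~ (m i < m (tgt k))%R) k i n w.

Definition wrong_pulls (i : 'I_N) (w : Omega) : R :=
  \sum_(n < T) \sum_(k | tgt k != i) x i k n.+1 w.

Let G0 : 0 < G. Proof. exact: G_eta_gt0. Qed.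

Lemma leading_term_ge0 : 0 <= leading_term.
Proof.
have g0 := lt_trans ltr01 hgamma.
apply: mulr_ge0; last by rewrite ln_ge0// ler1n.
apply: mulr_ge0; last by rewrite addr_ge0 ?sqrtr_ge0.
apply: divr_ge0; apply: mulr_ge0; rewrite ?sqr_ge0 ?(ltW G0) ?(ltW g0)//.
by rewrite mulr_ge0 ?sqr_ge0.
Qed.

Lemma enough_ge0 : 0 <= enough.
Proof. by rewrite addr_ge0 ?leading_term_ge0// mulr_ge0 ?ler0n ?(eps_n_ge0 spec). Qed.

Lemma misled_ge0 k i n w : 0 <= misled k i n w.
Proof.
by rewrite addr_ge0 ?deviation_ge0//; apply: sumr_ge0 => j _; exact: deviation_ge0.
Qed.

Lemma misled_ge1 k i n w : (N + M.*2 <= n)%N -> (n < T)%N -> tdag k <= n%:R ->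
  enough <= pulls i n w -> a k n.+1 w = i -> i != tgt k -> 1 <= misled k i n w.
Proof.
move=> Nn nT tn en ai it.
have M0 : 0 < M%:R :> R by rewrite ltr0n.
have NnT : (N <= n <= T)%N.
  by rewrite (leq_trans (leq_addr _ _) Nn) ltnW.
have NN : (N <= n)%N by case/andP: NnT.
have n1 : (1 < n)%N by exact: leq_trans hN NN.
have nh0 j : 0 < nhat P (fun k t => a k t w) j n k 0.
  apply: (nhat_gt0 P_ge0 P_sum P_sym P_conn spec hMN hN halg).
  rewrite (ltnW nT) andbT (leq_trans _ Nn)// leq_add2l leq_double.
  exact: leq_pred.
have [tdag0 tdagf] := f_inv_spec hf (hrange k).
have ef : eps_c lam u k <= f n%:R by exact: tdagf.
have /andP[t00 t01] := ht0.
have ffT : f n%:R <= f T%:R.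
  have [inc _] := hf; apply/ltW/inc; rewrite ?in_itv/= ?andbT ?ltr_nat//.
    by apply: (le_trans t01); rewrite ler1n ltnW.
  by apply: (le_trans t01); rewrite ler1n.
have := halg k w (t := n.+1) nT.
rewrite /coop_UCB2_selective_learning_at ltnNge NN /=.
move=> [S [[cS Stop] kS Smin]].
rewrite ai in kS Smin.
pose mu j := muhat P (fun i k t => r i k t w) (fun k t => a k t w) j k n.
pose C j := C_bonus P (fun k t => a k t w) sg gamma eta f j k n.
have gap : 2 * C i < D.
  apply: (@threshold_gap _ sg gamma G M%:R D (ln T%:R) (ln n%:R) (f T%:R)) => //.
  - exact: lt_trans ltr01 hgamma.
  - exact: Delta_min_gt0 hb hN.
  - by rewrite ln_ge0 ?ler1n ?(ltnW n1)//= ltr_ln ?posrE ?ltr0n ?ltr_nat// ltnW.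
  - by rewrite (le_trans (eps_c_ge0 spec k) ef).
  have := nhat_ge_average a spec w i n k.
  rewrite -(ler_pM2l M0) mulrBr mulVKf ?lt0r_neq0// => h.
  by move: en; rewrite /enough /pulls -/leading_term; lra.
have [[j Cj]|Ci] := selective_choice_deviates hb (mu := mu) (C := C) (k := widen_ord hMN k) cS Stop kS Smin it gap.
- rewrite /misled (bigD1 j)//=.
  have : 1 <= dev (m i < m (tgt k))%R k j n w.
    exact: (deviation_ge1 P_ge0 P_sum spec hMN hN halg hsg hgamma heta NnT (nh0 j) ef Cj).
  have := deviation_ge0 P r a m sg gamma eta f (~~ (m i < m (tgt k))%R) k i n w.
  have : 0 <= \sum_(l | l != j) dev (m i < m (tgt k))%R k l n w.
    by apply: sumr_ge0 => l _; exact: deviation_ge0.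
  lra.
- rewrite /misled.
  have : 1 <= dev (~~ (m i < m (tgt k))%R) k i n w.
    exact: (deviation_ge1 P_ge0 P_sum spec hMN hN halg hsg hgamma heta NnT (nh0 i) ef Ci).
  have : 0 <= \sum_l dev (m i < m (tgt k))%R k l n w.
    by apply: sumr_ge0 => l _; exact: deviation_ge0.
  lra.
Qed.

Let x01 i k t w : 0 <= x i k t w <= 1.
Proof. by rewrite /xi ler0n lern1 leq_b1. Qed.

(** The round robin is included: within it an agent pulls an arm at most once. *)
Let starved i n w := (n < N)%N || (pulls i n w < enough).

(** Before the last starved round the group has made fewer than [enough] pulls of
    [i], unless this round belongs to the round robin; the round itself adds at
    most [M]. *)
Lemma starved_pulls_le i w :
  \sum_(n < T) (starved i n w)%:R * \sum_k x i k n.+1 w <= enough + M%:R.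
Proof.
have x0 n : 0 <= \sum_k x i k n.+1 w.
  by apply: sumr_ge0 => k _; case/andP: (x01 i k n.+1 w).
suff H : forall n, (n <= T)%N ->
    \sum_(s < n) (starved i s w)%:R * \sum_k x i k s.+1 w <= pulls i n w /\
    \sum_(s < n) (starved i s w)%:R * \sum_k x i k s.+1 w <= enough + M%:R.
  by have [] := H T (leqnn T).
elim=> [_|n IH nT].
  by rewrite /pulls !big_ord0; split=> //; rewrite addr_ge0 ?enough_ge0.
have [IH1 IH2] := IH (ltnW nT).
have le1 : \sum_(s < n.+1) (starved i s w)%:R * \sum_k x i k s.+1 w <= pulls i n.+1 w.
  rewrite big_ord_recr /pulls big_ord_recr lerD//=.
  by rewrite ler_piMl// lern1 leq_b1.
split=> //; have [st|ns] := boolP (starved i n w); last first.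
  by rewrite big_ord_recr /= (negbTE ns) mul0r addr0.
apply: (le_trans le1); case/orP: st => st.
  apply: (@le_trans _ _ M%:R); last by rewrite lerDr enough_ge0.
  exact: (round_robin_count halg).
rewrite /pulls big_ord_recr /= lerD//; first exact: ltW.
rewrite -[leRHS](_ : \sum_(j < M) 1 = _); last by rewrite sumr_const card_ord.
by apply: ler_sum => k _; case/andP: (x01 i k n.+1 w).
Qed.

(** Pulls are charged to scarcity of data on arm [i], to an early round, in which
    counts may vanish or [f] is still below the centrality index, or to a
    deviation. *)
Lemma wrong_pulls_le i w : wrong_pulls i w <= enough + M%:R
  + \sum_(k < M) (2 * M%:R + tdag k)
  + \sum_(n < T | (N <= n)%N) \sum_k misled k i n w.
Proof.
pose early k n : R := ((N <= n < N + M.*2)%N)%:R + ((N <= n)%N && (n%:R < tdag k))%:R.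
have tdag_ge0 k : 0 <= tdag k.
  have [h _] := f_inv_spec hf (hrange k).
  by case/andP: ht0 => t00 _; exact: le_trans t00 h.
have split_pull k n : (n < T)%N -> tgt k != i -> x i k n.+1 w <=
    (starved i n w)%:R * x i k n.+1 w + early k n
    + (N <= n)%:R * misled k i n w.
  move=> nT ti; have /andP[x0 x1] := x01 i k n.+1 w.
  have e0 : 0 <= early k n by rewrite addr_ge0.
  have m0 := misled_ge0 k i n w.
  have [st|] := boolP (starved i n w).
    by rewrite mul1r -addrA lerDl addr_ge0// mulr_ge0.
  rewrite negb_or -leqNgt -leNgt => /andP[Nn en].
  rewrite mul0r add0r Nn mul1r.
  have [a_i|a_i] := eqVneq (a k n.+1 w) i; last first.
    by rewrite /xi (negbTE a_i) addr_ge0.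
  have [lt1|ge1] := ltnP n (N + M.*2).
    have : 1 <= early k n by rewrite /early Nn lt1 lerDl.
    lra.
  have [lt2|ge2] := ltP n%:R (tdag k).
    have : 1 <= early k n by rewrite /early Nn lt2 lerDr.
    lra.
  have : 1 <= misled k i n w by apply: misled_ge1 => //; rewrite eq_sym.
  lra.
apply: (@le_trans _ _ (\sum_(n < T) \sum_k ((starved i n w)%:R * x i k n.+1 w
    + early k n + (N <= n)%:R * misled k i n w))).
  apply: ler_sum => n _; rewrite big_mkcond /=; apply: ler_sum => k _.
  case: ifPn => ti; first exact: split_pull.
  have /andP[x0 x1] := x01 i k n.+1 w.
  by rewrite !addr_ge0 ?mulr_ge0 ?misled_ge0.
under eq_bigr do rewrite 2!big_split -!mulr_sumr /=.
rewrite 2!big_split /=.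
have h1 := starved_pulls_le i w.
have h2 : \sum_(n < T) \sum_k early k n <= \sum_(k < M) (2 * M%:R + tdag k).
  rewrite exchange_big; apply: ler_sum => k _; rewrite big_split lerD//=.
    by apply: le_trans (sum_window_le R N M.*2 T) _; rewrite -mul2n natrM.
  by apply: sum_before_le => //; exact: ltnW.
have h3 : \sum_(n < T) (N <= n)%:R * \sum_k misled k i n w =
    \sum_(n < T | (N <= n)%N) \sum_k misled k i n w.
  rewrite [RHS]big_mkcond; apply: eq_bigr => n _.
  by case: (N <= n)%N; rewrite ?mul1r ?mul0r.
rewrite h3; lra.
Qed.

Lemma measurable_deviation neg k i n : (n <= T)%N ->
  measurable_fun setT (dev neg k i n).
Proof.
move=> nT; apply: measurable_sum => h; apply: measurableT_comp => //.
apply: measurable_funB => //.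
exact: (measurable_compensated_exponent r m sg ha).
Qed.

Let cost n : R := (pieces eta n)%:R * expR (- (gamma * ln n%:R)).

Lemma integral_deviation neg k i n : (n <= T)%N ->
  (\int[Pr]_w (dev neg k i n w)%:E <= (cost n)%:E)%E.
Proof.
move=> nT; under eq_integral do rewrite /deviation -sumEFin.
rewrite ge0_integral_sum//; last first.
- move=> h; apply/measurable_EFinP; apply: measurableT_comp => //.
  apply: measurable_funB => //; exact: (measurable_compensated_exponent r m sg ha).
have -> : (cost n)%:E = (\sum_(h < pieces eta n) (expR (- (gamma * ln n%:R)))%:E)%E.
  by rewrite sumEFin sumr_const card_ord /cost mulr_natl.
apply: lee_sum => h _.
under eq_integral do rewrite addrC expRD EFinM.
rewrite ge0_integralZl//; last first.
- apply/measurable_EFinP; apply: measurableT_comp => //.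
  exact: (measurable_compensated_exponent r m sg ha).
rewrite -[leRHS]mule1 lee_wpmul2l ?lee_fin ?expR_ge0//.
exact: (expectation_exp_compensated ha hr).
Qed.

Lemma measurable_misled k i n : (n <= T)%N -> measurable_fun setT (misled k i n).
Proof.
move=> nT; apply: measurable_funD; last exact: measurable_deviation.
by apply: measurable_sum => j; exact: measurable_deviation.
Qed.

Lemma integral_misled k i n : (n <= T)%N ->
  (\int[Pr]_w (misled k i n w)%:E <= ((N%:R + 1) * cost n)%:E)%E.
Proof.
move=> nT; under eq_integral do rewrite EFinD -sumEFin.
have mdev neg j : measurable_fun setT (fun w => (dev neg k j n w)%:E).
  by apply/measurable_EFinP; exact: measurable_deviation.
have dev0 neg j w : (0 <= (dev neg k j n w)%:E)%E.
  by rewrite lee_fin deviation_ge0.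
rewrite ge0_integralD//; last 2 first.
- by move=> w _; exact: sume_ge0.
- exact: emeasurable_sum.
rewrite ge0_integral_sum// mulrDl mul1r EFinD leeD ?integral_deviation//.
have -> : (N%:R * cost n)%:E = (\sum_(j < N) (cost n)%:E)%E.
  by rewrite sumEFin sumr_const card_ord mulr_natl.
by apply: lee_sum => j _; exact: integral_deviation.
Qed.

Lemma sum_cost_le : \sum_(n < T | (N <= n)%N) cost n <=
  ((ln 2 + ln (1 + eta)) / (gamma - 1) + (gamma - 1)^-1 ^+ 2 + (gamma - 1)^-1)
  / ln (1 + eta).
Proof.
have L0 : 0 < ln (1 + eta) by exact: ln1eta_gt0 heta.
have a0 : 0 < gamma - 1 by rewrite subr_gt0.
have cost0 n : 0 <= cost n by rewrite mulr_ge0 ?expR_ge0.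
rewrite -(big_geq_mkord _ _ predT cost).
apply: (@le_trans _ _ (\sum_(2 <= n < T.+2) cost n)).
  have [NT|TN] := leqP N T; last first.
    by rewrite big_geq ?(ltnW TN)//; apply: sumr_ge0.
  have T2 : (T <= T.+2)%N by exact: leqW (leqnSn T).
  rewrite (big_cat_nat hN (leq_trans NT T2)) (big_cat_nat NT T2) /=.
  by rewrite addrCA lerDl addr_ge0// sumr_ge0.
pose t n : R := expR (- ((1 + (gamma - 1)) * ln n%:R)).
apply: (@le_trans _ _ (\sum_(2 <= n < T.+2)
    ((ln 2 + ln (1 + eta)) * t n + t n * ln n%:R) / ln (1 + eta))).
  apply: ler_sum_nat => n /andP[n2 _].
  have n0 : 0 < n%:R :> R by rewrite ltr0n (leq_trans _ n2).
  have := pieces_le heta n2.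
  rewrite lnM ?posrE// /cost => h.
  have -> : expR (- (gamma * ln n%:R)) = t n by rewrite /t addrC subrK.
  apply: le_trans (ler_wpM2r (expR_ge0 _) h) _.
  by rewrite -/(t n) le_eqVlt; apply/orP; left; apply/eqP; ring.
rewrite -mulr_suml ler_pM2r ?invr_gt0// big_split /= -mulr_sumr -addrA.
have c0 : 0 <= ln 2 + ln (1 + eta) by rewrite addr_ge0 ?(ltW L0)// ln_ge0// ler1n.
by rewrite lerD ?(sum_log_powers_le a0)// ler_wpM2l// (sum_powers_le a0).
Qed.

Lemma measurable_wrong_pulls i : measurable_fun setT (wrong_pulls i).
Proof.
have -> : wrong_pulls i =
    (fun w => \sum_(n < T) \sum_k (if tgt k != i then x i k n.+1 w else 0)).
  by apply/funext => w; rewrite /wrong_pulls; apply: eq_bigr => n _; exact: big_mkcond.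
apply: measurable_sum => n; apply: measurable_sum => k; case: (tgt k != i) => //.
have -> : (fun w => x i k n.+1 w) = \1_(a k n.+1 @^-1` [set i]) :> (Omega -> R).
  apply/funext => w; rewrite indicE /xi; congr (nat_of_bool _)%:R.
  by apply/eqP/idP; rewrite inE.
by apply: measurable_indic; apply: ha; rewrite ltn0Sn ltn_ord.
Qed.

Lemma wrong_pulls_ge0 i w : 0 <= wrong_pulls i w.
Proof.
by do 2! (apply: sumr_ge0 => ? _); rewrite /xi ler0n.
Qed.

Lemma expected_wrong_pulls_le i :
  (\int[Pr]_w (wrong_pulls i w)%:E <= (B_bound lam u sg gamma eta t0 f m T)%:E)%E.
Proof.
pose c := enough + M%:R + \sum_(k < M) (2 * M%:R + tdag k).
have c0 : 0 <= c.
  apply: addr_ge0; first by rewrite addr_ge0 ?enough_ge0.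
  apply: sumr_ge0 => k _; have [h _] := f_inv_spec hf (hrange k); rewrite addr_ge0//.
  by case/andP: ht0 => t00 _; exact: le_trans t00 h.
have mm (n : 'I_T) k : measurable_fun setT (fun w => (misled k i n w)%:E).
  by apply/measurable_EFinP; exact: measurable_misled (ltnW (ltn_ord n)).
have mis0 n k w : (0 <= (misled k i n w)%:E)%E by rewrite lee_fin misled_ge0.
pose late w : \bar R :=
  (\sum_(n < T) if (N <= n)%N then \sum_k (misled k i n w)%:E else 0)%E.
have mterm (n : 'I_T) : measurable_fun setT
    (fun w => if (N <= n)%N then \sum_k (misled k i n w)%:E else 0)%E.
  by case: (N <= n)%N => //; exact: emeasurable_sum.
have term0 (n : 'I_T) w :
    (0 <= if (N <= n)%N then \sum_k (misled k i n w)%:E else 0)%E.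
  by case: (N <= n)%N => //; exact: sume_ge0.
have late0 w : (0 <= late w)%E by apply: sume_ge0 => n _; exact: term0.
have mlate : measurable_fun setT late by exact: emeasurable_sum.
apply: (@le_trans _ _ (\int[Pr]_w (c%:E + late w))%E).
  apply: ge0_le_integral => //.
  - by move=> w _; rewrite lee_fin wrong_pulls_ge0.
  - by apply/measurable_EFinP; exact: measurable_wrong_pulls.
  - exact: emeasurable_funD.
  - move=> w _; apply: (@le_trans _ _ (c + \sum_(n < T | (N <= n)%N)
      \sum_k misled k i n w)%:E); first by rewrite lee_fin wrong_pulls_le.
    rewrite EFinD leeD2l// /late big_mkcond /= -sumEFin; apply: lee_sum => n _.
    by case: (N <= n)%N; rewrite ?sumEFin.
rewrite ge0_integralD// integral_cst//= probability_setT mule1.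
pose S := \sum_(n < T | (N <= n)%N) cost n.
apply: (@le_trans _ _ (c%:E + (M%:R * (N%:R + 1) * S)%:E)%E).
  rewrite leeD2l// ge0_integral_sum//.
  have -> : (M%:R * (N%:R + 1) * S)%:E =
      (\sum_(n < T) if (N <= n)%N then (M%:R * (N%:R + 1) * cost n)%:E else 0)%E.
    by rewrite /S mulr_sumr -sumEFin; exact: big_mkcond.
  apply: lee_sum => n _; case: (N <= n)%N; last by rewrite integral0.
  rewrite ge0_integral_sum//.
  have -> : (M%:R * (N%:R + 1) * cost n)%:E = (\sum_(k < M) ((N%:R + 1) * cost n)%:E)%E.
    by rewrite sumEFin sumr_const card_ord -mulrA mulr_natl.
  by apply: lee_sum => k _; exact: integral_misled (ltnW (ltn_ord n)).
rewrite -EFinD lee_fin.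
have L0 : 0 < ln (1 + eta) by exact: ln1eta_gt0 heta.
have LA : ln (1 + eta) <= ln ((1 + eps_n lam) * (1 + eta)).
  have e0 := eps_n_ge0 spec; have /andP[h0 _] := heta.
  rewrite ler_ln ?posrE; [|lra|by rewrite mulr_gt0//; lra].
  by rewrite ler_peMl//; lra.
have := excess_budget hMN hgamma L0 LA sum_cost_le.
have -> : c = leading_term + M%:R * (1 + eps_n lam)
    + \sum_(k < M) (tdag k - 1) + M%:R * (2 * M%:R + 1).
  rewrite /c /enough big_split sumrB /= !sumr_const !card_ord -[_ *+ M]mulr_natl.
  by rewrite -[1 *+ M]mulr_natl; ring.
rewrite /B_bound /L_bar -/S /= -/leading_term; lra.
Qed.

End PullCounts.

(** * From counts to regret *)

Section HasExpectation.
Context (R : realType) (d : measure_display) (Omega : measurableType d).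
Variable Pr : probability Omega R.

Definition has_expectation (F : Omega -> R) (v : R) :=
  Pr.-integrable setT (EFin \o F) /\ (\int[Pr]_w (F w)%:E = v%:E)%E.

Lemma expectation_of F v : has_expectation F v -> ('E_Pr[F] = v%:E)%E.
Proof. by case=> _; rewrite unlock. Qed.

Lemma has_expectation_sum (I : Type) (s : seq I) (Q : pred I) (F : I -> Omega -> R)
    (v : I -> R) : (forall i, has_expectation (F i) (v i)) ->
  has_expectation (fun w => \sum_(i <- s | Q i) F i w) (\sum_(i <- s | Q i) v i).
Proof.
move=> H; have E : EFin \o (fun w => \sum_(i <- s | Q i) F i w) =
    (fun w => \sum_(i <- s | Q i) (F i w)%:E)%E.
  by apply/funext => w; rewrite /= sumEFin.
split; first by rewrite E; apply: integrable_sum => // i _; case: (H i).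
under eq_integral do rewrite -sumEFin.
rewrite integral_sum//; last by move=> i; case: (H i).
by rewrite -sumEFin; apply: eq_bigr => i _; case: (H i).
Qed.

Lemma has_expectation_scale F v c : has_expectation F v ->
  has_expectation (fun w => c * F w) (c * v).
Proof.
move=> [intF eF]; split; last by rewrite EFinM -eF -integralZl.
exact: (integrableZl measurableT c intF).
Qed.

Lemma has_expectation_add F G v v' : has_expectation F v -> has_expectation G v' ->
  has_expectation (fun w => F w + G w) (v + v').
Proof.
move=> [intF eF] [intG eG]; split.
  exact: (integrableD measurableT intF intG).
by rewrite EFinD -eF -eG -integralD_EFin.
Qed.

Lemma has_expectation_ge F v c : has_expectation F v -> (forall w, c <= F w) -> c <= v.
Proof.
move=> [intF eF] cF; rewrite -lee_fin -eF.
have -> : c%:E = (\int[Pr]_w (cst c w)%:E)%E.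
  by have := expectation_cst Pr c; rewrite unlock => ->.
apply: le_integral => //; first exact: finite_measure_integrable_cst.
by move=> w _; rewrite lee_fin cF.
Qed.

Lemma has_expectation_indic (A : set Omega) : measurable A ->
  has_expectation \1_A (fine (Pr A)).
Proof.
move=> mA; split; first exact: integrable_indic.
by rewrite integral_indic// setIT fineK// fin_num_measure.
Qed.

Lemma finite_integral_integrable (X : Omega -> R) (v : R) :
  measurable_fun setT X -> (\int[Pr]_w (X w)%:E = v%:E)%E -> has_expectation X v.
Proof.
move=> mX eX; split=> //; apply/integrableP; split; first exact/measurable_EFinP.
have mE : measurable_fun setT (EFin \o X) by exact/measurable_EFinP.
have -> : (fun w => `|(EFin \o X) w|)%E = ((EFin \o X)^\+ \+ (EFin \o X)^\-)%E.
  by rewrite -fune_abse.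
rewrite ge0_integralD//; [|exact: measurable_funepos|exact: measurable_funeneg].
move: (eX); rewrite [in X in X -> _]integralE.
have p0 : (0 <= \int[Pr]_w ((EFin \o X)^\+ w))%E by apply: integral_ge0.
have n0 : (0 <= \int[Pr]_w ((EFin \o X)^\- w))%E by apply: integral_ge0.
move: p0 n0.
set p := (\int[Pr]_w ((EFin \o X)^\+ w))%E; set n := (\int[Pr]_w ((EFin \o X)^\- w))%E.
by clearbody p n; case: p n => [y| |] [z| |] //= _ _ _; rewrite ltry.
Qed.

(** Positive and negative parts carry [integral_factor] over to signed variables. *)
Lemma has_expectation_factor (X : Omega -> R) (A : set Omega) (v : R) :
  measurable_fun setT X -> measurable A -> has_expectation X v ->
  (forall B : set R, measurable B -> Pr (X @^-1` B `&` A) = (Pr (X @^-1` B) * Pr A)%E) ->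
  has_expectation (fun w => X w * \1_A w) (v * fine (Pr A)).
Proof.
move=> mX mA [intX eX] indep.
have fA : Pr A \is a fin_num by rewrite fin_num_measure.
have key (g : R -> R) : measurable_fun setT g -> (forall y, 0 <= g y) ->
    (\int[Pr]_w (\1_A w * g (X w))%:E = Pr A * \int[Pr]_w (g (X w))%:E)%E.
  move=> mg g0; rewrite -[in RHS](fineK fA); apply: integral_factor => // B mB.
  have -> : (fun w => (\1_A w * \1_B (X w))%:E) =
      (fun w => (\1_(X @^-1` B `&` A) w)%:E : \bar R).
    by apply/funext => w; rewrite indicI mulrC.
  have mXB : measurable (X @^-1` B) by rewrite -[X in measurable X]setTI; exact: mX.
  rewrite integral_indic ?setIT//; last exact: measurableI.
  by apply: etrans (indep B mB) _; rewrite fineK// muleC.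
split.
  have -> : EFin \o (fun w => X w * \1_A w) = ((EFin \o X) \* (EFin \o \1_A))%E.
    by apply/funext => w; rewrite /= EFinM.
  apply: integrableMl => //.
  exists 1; split; first by rewrite num_real.
  by move=> y y1 w _ /=; rewrite ger0_norm// (le_trans _ (ltW y1))// indicE lern1 leq_b1.
pose pos (y : R) := Num.max y 0; pose neg (y : R) := Num.max (- y) 0.
have mpos : measurable_fun setT pos by exact: measurable_maxr.
have mneg : measurable_fun setT neg by apply: measurable_maxr => //.
have posE w : pos (X w * \1_A w) = \1_A w * pos (X w).
  by rewrite /pos indicE; case: (w \in A); rewrite ?mulr1 ?mul1r// mulr0 mul0r maxxx.
have negE w : neg (X w * \1_A w) = \1_A w * neg (X w).
  by rewrite /neg indicE; case: (w \in A); rewrite ?mulr1 ?mul1r// mulr0 mul0r oppr0 maxxx.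
have posI (Y : Omega -> R) :
    (\int[Pr]_w (pos (Y w))%:E = \int[Pr]_w ((EFin \o Y)^\+ w))%E.
  by apply: eq_integral => w _; rewrite /pos funeposE /= EFin_max.
have negI (Y : Omega -> R) :
    (\int[Pr]_w (neg (Y w))%:E = \int[Pr]_w ((EFin \o Y)^\- w))%E.
  by apply: eq_integral => w _; rewrite /neg funenegE /= EFin_max.
have split_int (Y : Omega -> R) : (\int[Pr]_w (Y w)%:E =
    \int[Pr]_w (pos (Y w))%:E - \int[Pr]_w (neg (Y w))%:E)%E.
  by rewrite posI negI integralE.
rewrite split_int; under eq_integral do rewrite posE.
under [X in (_ - X)%E]eq_integral do rewrite negE.
rewrite !key//; try by move=> y; rewrite le_max lexx orbT.
rewrite -muleBr//; first by rewrite -split_int eX mulrC EFinM fineK.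
rewrite negI fin_num_adde_defl// fin_numN.
exact: integrable_neg_fin_num.
Qed.

End HasExpectation.

Section RegretDecomposition.
Context (R : realType) (d : measure_display) (Omega : measurableType d).
Variables (Pr : probability Omega R) (M N T : nat) (hMN : (M <= N)%N).
Variables (r : 'I_N -> 'I_M -> nat -> {RV Pr >-> R}).
Variables (a : 'I_M -> nat -> Omega -> 'I_N) (m : 'I_N -> R) (sg : R).
Variables (b : {perm 'I_N}).
Hypotheses (ha : random_selections T a) (hr : reward_model T r a m sg).

Local Notation sole t w := (sole_sampler R (fun j' => a j' t w)).

Definition alone (k : 'I_M) (t : nat) (i : 'I_N) : set Omega :=
  [set w | (a k t w == i) && [forall j, (j != k) ==> (a j t w != i)]].

Let p (k : 'I_M) (t : nat) (i : 'I_N) : R := fine (Pr (alone k t i)).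

Let soleE k t i w : sole t w i k = \1_(alone k t i) w.
Proof.
rewrite /sole_sampler indicE; congr (nat_of_bool _)%:R.
by apply/idP/idP; rewrite inE.
Qed.

Let aloneE k t i : alone k t i = a k t @^-1` [set i] `&`
  \bigcap_(j in [set j | j != k]) ~` (a j t @^-1` [set i]).
Proof.
apply/seteqP; split=> w /=.
  case/andP=> /eqP ak /forallP h; split=> // j jk; have := h j.
  by rewrite jk /= => /eqP.
case=> ak h; apply/andP; split; first exact/eqP.
by apply/forallP => j; apply/implyP => jk; apply/eqP; exact: h.
Qed.

Let finite_others (k : 'I_M) : finite_set [set j | j != k].
Proof. exact: finite_finset. Qed.

Let history_alone k t i : (0 < t)%N -> history_before r a t (alone k t i).
Proof.
move=> t0; rewrite /history_before; set gen := (X in <<s X >>).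
pose E (j : 'I_M) : set (g_sigma_algebraType gen) := a j t @^-1` [set i].
have mE j : measurable (E j).
  by apply: sub_sigma_algebra; right; exists j, t, i; rewrite t0 leqnn.
rewrite aloneE; apply: (@measurableI _ (g_sigma_algebraType gen)).
  exact: mE.
apply: (@fin_bigcap_measurable _ (g_sigma_algebraType gen)).
  exact: finite_others.
by move=> j _; apply: (@measurableC _ (g_sigma_algebraType gen)); exact: mE.
Qed.

Let measurable_alone k t i : (0 < t <= T)%N -> measurable (alone k t i).
Proof.
move=> tT; rewrite aloneE.
apply: measurableI; first exact: ha.
by apply: fin_bigcap_measurable => // j _; apply: measurableC; exact: ha.
Qed.

(** The event that [k] is alone on arm [i] belongs to the history before round
    [t], of which the reward of round [t] is independent. *)
Lemma expected_received k t : (0 < t <= T)%N ->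
  ('E_Pr[fun w => (\sum_(i < N) r i k t w * (a k t w == i)%:R * sole t w i k)%R]
   = (\sum_i m i * p k t i)%:E)%E.
Proof.
move=> tT; apply: expectation_of.
have -> : (fun w => \sum_(i < N) r i k t w * (a k t w == i)%:R * sole t w i k) =
    (fun w => \sum_(i < N) r i k t w * \1_(alone k t i) w).
  apply/funext => w; apply: eq_bigr => i _; rewrite -soleE -mulrA; congr (_ * _).
  by rewrite /sole_sampler; case: (a k t w == i); rewrite ?mul1r// mul0r.
apply: has_expectation_sum => i; have mA := measurable_alone k i tT.
apply: has_expectation_factor => //.
- apply: finite_integral_integrable => //.
  by have [/(_ i k t tT)[+ _] _ _ _] := hr; rewrite unlock.
- move=> B mB; have [_ _ _ /(_ t tT)] := hr; apply.
    by apply: sub_sigma_algebra; exists i, k, B.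
  by apply: history_alone; case/andP: tT.
Qed.

Lemma expected_group_gain :
  has_expectation Pr (fun w => \sum_(1 <= t < T.+1) \sum_(k < M)
                        m (a k t w) * sole t w (a k t w) k)
    (\sum_(t < T) \sum_k \sum_i m i * p k t.+1 i).
Proof.
have -> : (fun w => \sum_(1 <= t < T.+1) \sum_(k < M) m (a k t w) * sole t w (a k t w) k)
    = (fun w => \sum_(t < T) \sum_k \sum_i m i * \1_(alone k t.+1 i) w).
  apply/funext => w; rewrite big_add1 big_mkord; apply: eq_bigr => t _.
  apply: eq_bigr => k _; rewrite (bigD1 (a k t.+1 w))//= -soleE big1 ?addr0// => i.
  by rewrite -soleE /sole_sampler eq_sym => /negbTE->; rewrite mulr0.
apply: has_expectation_sum => t; apply: has_expectation_sum => k.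
apply: has_expectation_sum => i; apply: has_expectation_scale.
by apply: has_expectation_indic; apply: measurable_alone; rewrite ltn0Sn ltn_ord.
Qed.

Lemma sum_regret :
  (\sum_(k < M) regret hMN m b T r a k = group_regret hMN m b Pr T a)%E.
Proof.
rewrite /group_regret (expectation_of expected_group_gain).
have -> : (\sum_(k < M) regret hMN m b T r a k =
    \sum_(k < M) (\sum_(t < T) (m (target hMN b k) - \sum_i m i * p k t.+1 i))%:E)%E.
  apply: eq_bigr => k _; rewrite /regret big_add1 big_mkord -sumEFin.
  by apply: eq_bigr => t _; rewrite expected_received// ltn0Sn ltn_ord.
rewrite sumEFin -EFinB exchange_big /=; congr _%:E.
under eq_bigr do rewrite sumrB.
by rewrite sumrB sumr_const card_ord mulr_natl.
Qed.

Hypothesis m_ge0 : forall i, 0 <= m i.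
Hypothesis hb : ranking m b.
Hypothesis hM : (0 < M)%N.

Local Notation best := (target hMN b (Ordinal hM)).

Lemma le_best i : m i <= m best.
Proof. by rewrite -(permKV b i) /target (ranking_le hb). Qed.

(** An agent that misses its own arm loses at most the best mean, charged to the
    arm it pulled instead; an agent that collides on its own arm loses the mean
    of that arm, charged to the intruder. *)
Lemma round_loss_le t w :
  \sum_(k < M) m (target hMN b k) <=
  \sum_(k < M) m (a k t w) * sole t w (a k t w) k
  + \sum_(i < N) m best * \sum_(k | target hMN b k != i) (a k t w == i)%:R
  + \sum_(k < M) m (target hMN b k) *
      \sum_(j | target hMN b j != target hMN b k) (a j t w == target hMN b k)%:R.
Proof.
have -> : \sum_(i < N) m best * \sum_(k | target hMN b k != i) (a k t w == i)%:R =
    \sum_(k < M) m best * (a k t w != target hMN b k)%:R.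
  rewrite -mulr_sumr -mulr_sumr; congr (_ * _).
  under eq_bigr do rewrite big_mkcond /=.
  rewrite exchange_big; apply: eq_bigr => k _ /=.
  rewrite (bigD1 (a k t w))//= eqxx eq_sym big1 ?addr0; last first.
    by move=> i; rewrite eq_sym => /negbTE ->; case: ifP.
  by case: (a k t w == _).
rewrite -!big_split /=; apply: ler_sum => k _.
have s0 c : 0 <= m (a k t w) * sole t w c k by rewrite mulr_ge0 ?ler0n.
have o0 : 0 <= \sum_(j | target hMN b j != target hMN b k) (a j t w == target hMN b k)%:R :> R.
  by apply: sumr_ge0.
have mk := m_ge0 (target hMN b k).
have [ak|ak] := eqVneq (a k t w) (target hMN b k); last first.
  rewrite mulr1 -addrA -[leLHS]add0r lerD// -[leLHS]addr0 lerD ?le_best//.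
  exact: mulr_ge0.
rewrite mulr0 addr0 ak /sole_sampler ak eqxx /=.
have [_|] := boolP [forall j, (j != k) ==> (a j t w != target hMN b k)].
  by rewrite mulr1 lerDl mulr_ge0.
rewrite negb_forall => /existsP[j]; rewrite negb_imply negbK => /andP[jk aj].
rewrite mulr0 add0r ler_peMr// (bigD1 j)/=.
  by rewrite aj lerDl; apply: sumr_ge0.
rewrite /target (inj_eq perm_inj); apply: contra jk => /eqP[e].
by apply/eqP; exact: val_inj.
Qed.

Lemma sum_regret_le (loss : 'I_N -> Omega -> R) (B : R) :
  (forall i w, loss i w = \sum_(t < T) \sum_(k | target hMN b k != i)
                            (a k t.+1 w == i)%:R) ->
  (forall i, measurable_fun setT (loss i)) ->
  (forall i, \int[Pr]_w (loss i w)%:E <= B%:E)%E ->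
  (\sum_(k < M) regret hMN m b T r a k <=
   (m best * N%:R * B + \sum_(k < M) m (target hMN b k) * B)%:E)%E.
Proof.
move=> lossE mloss lossB; rewrite sum_regret /group_regret.
rewrite (expectation_of expected_group_gain) -EFinB lee_fin.
set gain := \sum_(t < T) _.
have loss0 i w : 0 <= loss i w.
  by rewrite lossE; do 2! (apply: sumr_ge0 => ? _); rewrite ler0n.
pose v i := fine (\int[Pr]_w (loss i w)%:E)%E.
have fin i : (\int[Pr]_w (loss i w)%:E)%E \is a fin_num.
  rewrite ge0_fin_numE; first by rewrite (le_lt_trans (lossB i)) ?ltry.
  by apply: integral_ge0 => w _; rewrite lee_fin.
have vB i : v i <= B by rewrite -lee_fin fineK.
have hloss i : has_expectation Pr (loss i) (v i).
  by apply: finite_integral_integrable => //; rewrite fineK.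
have H := has_expectation_add (has_expectation_add expected_group_gain
  (has_expectation_sum (index_enum 'I_N) xpredT
    (fun i => has_expectation_scale (m best) (hloss i))))
  (has_expectation_sum (index_enum 'I_M) xpredT
    (fun k => has_expectation_scale (m (target hMN b k)) (hloss (target hMN b k)))).
have := has_expectation_ge H (c := T%:R * \sum_(k < M) m (target hMN b k)).
rewrite -/gain => h.
have {}h := h _.
have v1 : \sum_(i < N) m best * v i <= m best * N%:R * B.
  have -> : m best * N%:R * B = \sum_(i < N) m best * B.
    by rewrite sumr_const card_ord -mulrnAl mulr_natr.
  by apply: ler_sum => i _; rewrite ler_wpM2l.
have v2 : \sum_(k < M) m (target hMN b k) * v (target hMN b k) <=
    \sum_(k < M) m (target hMN b k) * B.
  by apply: ler_sum => k _; rewrite ler_wpM2l.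
rewrite lerBlDl; apply: le_trans (h _) _; last by rewrite -addrA lerD2l lerD.
move=> w; rewrite big_add1 big_mkord.
have -> : T%:R * \sum_(k < M) m (target hMN b k) =
    \sum_(t < T) \sum_(k < M) m (target hMN b k).
  by rewrite sumr_const card_ord mulr_natl.
have -> : \sum_(i < N) m best * loss i w = \sum_(t < T) \sum_(i < N)
    m best * \sum_(k | target hMN b k != i) (a k t.+1 w == i)%:R.
  under eq_bigr do rewrite lossE mulr_sumr.
  exact: exchange_big.
have -> : \sum_(k < M) m (target hMN b k) * loss (target hMN b k) w =
    \sum_(t < T) \sum_(k < M) m (target hMN b k) *
      \sum_(j | target hMN b j != target hMN b k) (a j t.+1 w == target hMN b k)%:R.
  under eq_bigr do rewrite lossE mulr_sumr.
  exact: exchange_big.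
rewrite -!big_split /=; apply: ler_sum => t _; exact: round_loss_le.
Qed.

End RegretDecomposition.

Theorem corollary2 (R : realType) (d : measure_display)
    (Omega : measurableType d) (Pr : probability Omega R)
    (M N T : nat) (hM : (0 < M)%N) (hMN : (M <= N)%N) (hN : (1 < N)%N)
    (hT : (0 < T)%N)
    (e : rel 'I_M) (he : simple_graph e) (hconn : connected_graph e)
    (kappa : R) (hkappa : 0 < kappa <= 1)
    (lam : 'I_M -> R) (u : 'I_M -> 'cV[R]_M)
    (hspec : consensus_spectrum (consensus_matrix e kappa) lam u)
    (m : 'I_N -> R) (b : {perm 'I_N}) (hb : ranking m b)
    (sg gamma eta : R)
    (hsg : 0 < sg) (hgamma : 1 < gamma) (heta : 0 < eta < 4)
    (t0 : R) (ht0 : 0 <= t0 <= 1)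
    (f : R -> R) (hf : increasing_sublogarithmic t0 f)
    (hrange : forall k, (f @` [set x | t0 <= x]) (eps_c lam u k))
    (r : 'I_N -> 'I_M -> nat -> {RV Pr >-> R})
    (a : 'I_M -> nat -> Omega -> 'I_N)
    (ha : random_selections T a)
    (hr : reward_model T r a m sg)
    (halg : coop_UCB2_selective_learning T (consensus_matrix e kappa)
              sg gamma eta f r a) :
  let B := B_bound lam u sg gamma eta t0 f m T in
  (group_regret hMN m b Pr T a <= \sum_(k < M) regret hMN m b T r a k)%E /\
  ((forall i, 0 <= m i) ->
   (\sum_(k < M) regret hMN m b T r a k <=
    (m (target hMN b (Ordinal hM)) * N%:R * B +
     \sum_(k < M) m (target hMN b k) * B)%R%:E)%E).
Proof.
move=> B; split; first by rewrite (sum_regret hMN b ha hr).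
move=> m_ge0.
apply: (sum_regret_le ha hr m_ge0 hb hM (loss := wrong_pulls R T hMN b a)) => //.
  exact: measurable_wrong_pulls ha.
move=> i; apply: (expected_wrong_pulls_le hM hMN hN hT
  (consensus_matrix_ge0 he hkappa) (consensus_matrix_sum e kappa)
  (consensus_matrix_sym kappa he)
  (consensus_matrix_connect he hkappa hconn) hspec hb hsg hgamma heta ht0 hf hrange
  ha hr halg i).
Qed.
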